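(* For every real Banach space $Y$ with property quasi-$\beta$, the set $\mathrm{BS}_a(L_1[0,1],Y)$ is norm-dense in $\mathcal{L}(L_1[0,1],Y)$.
   Context: All Banach spaces are real. $S_X$ and $B_X$ are the unit sphere and closed unit ball of $X$, and $\mathcal{L}(X,Y)$ is the space of bounded linear operators from $X$ to $Y$ with the operator norm. For $T\in\mathcal{L}(X,Y)$ put $M_T=\{x\in S_X:\|Tx\|=\|T\|\}$; $T$ attains its norm if $M_T\neq\emptyset$, and $\mathrm{NA}(X,Y)$ is the set of norm attaining operators. $L_1[0,1]$ is taken with respect to Lebesgue measure. For vectors $x,y$ of a Banach space: $x\perp_B y$ means $\|x\|\le\|x+\lambda y\|$ for all $\lambda\in\mathbb{R}$; $x\perp_S y$ means $\|x\|<\|x+\lambda y\|$ for all $\lambda\in\mathbb{R}\setminus\{0\}$. $\mathrm{BS}_a(X,Y)$ (operators with the adjusted Bhatia-Šemrl property) is the set of $T\in\mathrm{NA}(X,Y)$ such that for every $S\in\mathcal{L}(X,Y)$ with $T\perp_S S$ there is $x_0\in M_T$ with $Tx_0\perp_B Sx_0$. A Banach space $Y$ has property quasi-$\beta$ if there are a set $A\subseteq S_{Y^*}$, a map $\sigma:A\to S_Y$ and a function $\rho:A\to\mathbb{R}$ such that: (i) $y^*(\sigma(y^* ))=1$ for every $y^*\in A$; (ii) $|z^*(\sigma(y^* ))|\le\rho(y^* )<1$ whenever $y^*,z^*\in A$, $y^*\ne z^*$; (iii) for every extreme point $e^*$ of $B_{Y^*}$ there are a subset $A_{e^*}\subseteq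 A$ and a scalar $t$ with $|t|=1$ such that $te^*$ lies in the weak-$*$ closure of $A_{e^*}$ and $\sup\{\rho(y^* ):y^*\in A_{e^*}\}<1$. *)

(* Defs.v *)
From HB Require Import structures.
From mathcomp Require Import all_boot all_order all_algebra.
From mathcomp Require Import all_classical all_reals all_analysis.
From mathcomp Require Import measurable_realfun ess_sup_inf.

Set Implicit Arguments.
Unset Strict Implicit.
Unset Printing Implicit Defensive.

Import Order.TTheory GRing.Theory Num.Theory.
Import numFieldNormedType.Exports.

Local Open Scope classical_set_scope.
Local Open Scope ring_scope.

(** * The normed space structure of L^p

    [LspaceType mu p1] consists of the a.e.-classes of measurable functions with
    finite L^p-norm; the library leaves it without algebraic structure. *)

Section Lspace_normedModType.
Context d (T : measurableType d) (R : realType).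
Variables (mu : {measure set T -> \bar R}) (p : \bar R) (p1 : (1 <= p)%E).

HB.instance Definition _ := gen_eqMixin (LspaceType mu p1).
HB.instance Definition _ := gen_choiceMixin (LspaceType mu p1).

Lemma ae_eq_Lnorm (f g : T -> R) :
  measurable_fun setT f -> measurable_fun setT g -> f = g %[ae mu] ->
  ('N[mu]_p[EFin \o f] = 'N[mu]_p[EFin \o g])%E.
Proof.
move=> mf mg fg; rewrite unlock /Lnorm; case: p p1 => [r r1|_|//].
- congr (_ `^ _)%E; apply: ae_eq_integral => //.
  + apply/measurable_EFinP; apply: (measurableT_comp (measurable_powR _)).
    exact: measurableT_comp.
  + apply/measurable_EFinP; apply: (measurableT_comp (measurable_powR _)).
    exact: measurableT_comp.
  + by apply: filterS fg => x /= /[apply] ->.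
- case: ifPn => // mu0; apply: eq_ess_sup.
  by apply: filterS fg => x /= ->.
Qed.

Lemma repr_Lspace_in (f : LspaceType mu p1) :
  (repr (f : {mfun_ mu, T >-> measurableTypeR R}) : T -> R) \in Lfun mu p.
Proof.
apply/andP; split; rewrite inE /=.
  exact: (@measurable_funPT _ _ T (measurableTypeR R)).
exact: (@Lebesgue_finite _ _ _ _ _ _ f).
Qed.

(* a representative of a class *)
Definition Lspace_repr (f : LspaceType mu p1) : LfunType mu p1 :=
  Lfun_Sub p1 (repr_Lspace_in f).

(* the a.e.-classes of the library are valued in [measurableTypeR R], whose
   display differs from the one of [R] *)
Definition Lfun_measurableTypeR (f : LfunType mu p1) :
  T -> measurableTypeR R := f.

Lemma measurable_Lfun_measurableTypeR (f : LfunType mu p1) :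
  measurable_fun setT (Lfun_measurableTypeR f).
Proof. exact: (@measurable_funPT _ _ T R f). Qed.

HB.instance Definition _ (f : LfunType mu p1) :=
  isMeasurableFun.Build _ _ T (measurableTypeR R) (Lfun_measurableTypeR f)
    (measurable_Lfun_measurableTypeR f).

Definition aeEq_of_Lfun (f : LfunType mu p1) :
    {mfun_ mu, T >-> measurableTypeR R} :=
  (\pi_({mfun_ mu, T >-> measurableTypeR R}) (Lfun_measurableTypeR f))%qT.

Lemma repr_aeEq_of_Lfun (f : LfunType mu p1) :
  (repr (aeEq_of_Lfun f) : T -> R) = f %[ae mu].
Proof.
have /eqmodP/asboolP : (\pi_({mfun_ mu, T >-> measurableTypeR R})
   (repr (aeEq_of_Lfun f)) = aeEq_of_Lfun f)%qT by rewrite reprK.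
by [].
Qed.

Lemma finite_norm_aeEq_of_Lfun (f : LfunType mu p1) :
  finite_norm mu p (aeEq_of_Lfun f : T -> R).
Proof.
rewrite /finite_norm (@ae_eq_Lnorm _ f).
- exact: Lfunction_finite.
- exact: (@measurable_funPT _ _ T (measurableTypeR R)).
- exact: measurable_funPT.
- exact: repr_aeEq_of_Lfun.
Qed.

HB.instance Definition _ (f : LfunType mu p1) :=
  isFinLebesgue.Build d T R mu p p1 (aeEq_of_Lfun f) (finite_norm_aeEq_of_Lfun f).

(* the class of a function *)
Definition Lspace_class (f : LfunType mu p1) : LspaceType mu p1 :=
  aeEq_of_Lfun f.

Lemma Lspace_inj (f g : LspaceType mu p1) :
  (f : {mfun_ mu, T >-> measurableTypeR R}) = g -> f = g.
Proof.
case: f g => [f [[cf]]] [g [[cg]]] /= fg; move: cf cg; rewrite fg => cf cg.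
by rewrite (Prop_irrelevance cf cg).
Qed.

Lemma Lspace_classP (f g : LfunType mu p1) :
  (f : T -> R) = g %[ae mu] <-> Lspace_class f = Lspace_class g.
Proof.
split=> [fg|].
  by apply: Lspace_inj => /=; apply/eqmodP/asboolP.
move=> /(congr1 (fun h : LspaceType mu p1 =>
  (h : {mfun_ mu, T >-> measurableTypeR R}))) /=.
by move=> /eqmodP/asboolP.
Qed.

Lemma Lspace_reprK : cancel Lspace_repr Lspace_class.
Proof.
move=> f; apply: Lspace_inj => /=.
by rewrite -[RHS]reprK; apply/eqmodP/asboolP/ae_eq_refl.
Qed.

Lemma Lspace_classK (f : LfunType mu p1) :
  (Lspace_repr (Lspace_class f) : T -> R) = f %[ae mu].
Proof. exact: repr_aeEq_of_Lfun. Qed.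

Definition Lspace_zero : LspaceType mu p1 := Lspace_class 0.
Definition Lspace_opp (f : LspaceType mu p1) := Lspace_class (- Lspace_repr f).
Definition Lspace_add (f g : LspaceType mu p1) :=
  Lspace_class (Lspace_repr f + Lspace_repr g).
Definition Lspace_scale (a : R) (f : LspaceType mu p1) :=
  Lspace_class (a *: Lspace_repr f).

Lemma Lspace_classD (f g : LfunType mu p1) :
  Lspace_class (f + g) = Lspace_add (Lspace_class f) (Lspace_class g).
Proof.
apply/Lspace_classP; move: (Lspace_classK f) (Lspace_classK g).
apply: filterS2 => x /(_ I) fx /(_ I) gx _.
change (f x + g x = Lspace_repr (Lspace_class f) x + Lspace_repr (Lspace_class g) x).
by rewrite fx gx.
Qed.

Lemma Lspace_classZ a (f : LfunType mu p1) :
  Lspace_class (a *: f) = Lspace_scale a (Lspace_class f).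
Proof.
apply/Lspace_classP; move: (Lspace_classK f).
apply: filterS => x /(_ I) fx _.
change (a * f x = a * Lspace_repr (Lspace_class f) x).
by rewrite fx.
Qed.

Lemma Lspace_classN (f : LfunType mu p1) :
  Lspace_class (- f) = Lspace_opp (Lspace_class f).
Proof.
apply/Lspace_classP; move: (Lspace_classK f).
apply: filterS => x /(_ I) fx _.
change (- f x = - Lspace_repr (Lspace_class f) x).
by rewrite fx.
Qed.

Lemma Lspace_addA : associative Lspace_add.
Proof.
move=> f g h; rewrite -[f]Lspace_reprK -[g]Lspace_reprK -[h]Lspace_reprK.
by rewrite -!Lspace_classD addrA.
Qed.

Lemma Lspace_addC : commutative Lspace_add.
Proof.
move=> f g; rewrite -[f]Lspace_reprK -[g]Lspace_reprK.
by rewrite -!Lspace_classD addrC.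
Qed.

Lemma Lspace_add0 : left_id Lspace_zero Lspace_add.
Proof. by move=> f; rewrite -[f]Lspace_reprK -Lspace_classD add0r. Qed.

Lemma Lspace_addN : left_inverse Lspace_zero Lspace_opp Lspace_add.
Proof.
by move=> f; rewrite -[f]Lspace_reprK -Lspace_classN -Lspace_classD addNr.
Qed.

HB.instance Definition _ := GRing.isZmodule.Build (LspaceType mu p1)
  Lspace_addA Lspace_addC Lspace_add0 Lspace_addN.

Lemma Lspace_scaleA a b (f : LspaceType mu p1) :
  Lspace_scale a (Lspace_scale b f) = Lspace_scale (a * b) f.
Proof. by rewrite -[f]Lspace_reprK -!Lspace_classZ scalerA. Qed.

Lemma Lspace_scale1 : left_id 1 Lspace_scale.
Proof. by move=> f; rewrite -[f]Lspace_reprK -!Lspace_classZ scale1r. Qed.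

Lemma Lspace_scaleDr : right_distributive Lspace_scale +%R.
Proof.
move=> a f g; rewrite -[f]Lspace_reprK -[g]Lspace_reprK /GRing.add/=.
by rewrite -!(Lspace_classZ, Lspace_classD) scalerDr.
Qed.

Lemma Lspace_scaleDl (f : LspaceType mu p1) :
  {morph Lspace_scale^~ f : a b / a + b}.
Proof.
move=> a b /=; rewrite -[f]Lspace_reprK [in RHS]/GRing.add/=.
by rewrite -!(Lspace_classZ, Lspace_classD) scalerDl.
Qed.

HB.instance Definition _ := GRing.Zmodule_isLmodule.Build R (LspaceType mu p1)
  Lspace_scaleA Lspace_scale1 Lspace_scaleDr Lspace_scaleDl.

Definition Lspace_norm (f : LspaceType mu p1) : R :=
  fine ('N[mu]_p[EFin \o (f : T -> R)])%E.

Lemma Lspace_norm_class (f : LfunType mu p1) :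
  Lspace_norm (Lspace_class f) = fine ('N[mu]_p[EFin \o f])%E.
Proof.
congr fine; apply: ae_eq_Lnorm.
- exact: (@measurable_funPT _ _ T (measurableTypeR R)).
- exact: measurable_funPT.
- exact: repr_aeEq_of_Lfun.
Qed.

Lemma ler_Lspace_normD (f g : LspaceType mu p1) :
  Lspace_norm (f + g) <= Lspace_norm f + Lspace_norm g.
Proof.
rewrite -[f]Lspace_reprK -[g]Lspace_reprK /GRing.add/= -Lspace_classD.
by rewrite !Lspace_norm_class ler_LnormD.
Qed.

Lemma Lspace_normZ a (f : LspaceType mu p1) :
  Lspace_norm (a *: f) = `|a| * Lspace_norm f.
Proof.
rewrite -[f]Lspace_reprK /GRing.scale/= -Lspace_classZ !Lspace_norm_class.
by apply: EFin_inj; rewrite EFinM !finite_norm_fine LnormZ.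
Qed.

Lemma Lspace_norm_eq0 (f : LspaceType mu p1) : Lspace_norm f = 0 -> f = 0.
Proof.
rewrite -[f]Lspace_reprK Lspace_norm_class => /fine_Lnormr_eq0 f0.
exact/Lspace_classP.
Qed.

HB.instance Definition _ := Lmodule_isNormed.Build R (LspaceType mu p1)
  ler_Lspace_normD Lspace_normZ Lspace_norm_eq0.

End Lspace_normedModType.

Section unit_ball_sphere.
Context (R : realType) (X : normedModType R).

Definition unit_ball : set X := [set x | `|x| <= 1].

Definition unit_sphere : set X := [set x | `|x| = 1].

End unit_ball_sphere.

Arguments unit_ball {R} X _.
Arguments unit_sphere {R} X _.

(** * The normed space of bounded linear operators *)

Section bounded_operators.
Context (R : realType) (X Y : normedModType R).

Definition bounded_operator : {pred X -> Y} :=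
  mem [set T : X -> Y | linear T /\
                        exists M : R, forall x, `|T x| <= M * `|x|].

Record Bop := MkBop {
  Bop_fun :> X -> Y;
  Bop_bounded : Bop_fun \in bounded_operator }.

HB.instance Definition _ := [isSub for Bop_fun].
HB.instance Definition _ := [Choice of Bop by <:].

Lemma Bop_linear (T : Bop) : linear T.
Proof. by case: T => T /= /set_mem[]. Qed.

HB.instance Definition _ (T : Bop) :=
  GRing.isLinear.Build R X Y *:%R T (Bop_linear T).

Lemma bounded_operator_submod_closed : submod_closed bounded_operator.
Proof.
split.
  rewrite inE; split; first by move=> a x y; rewrite scaler0 addr0.
  by exists 0 => x; rewrite normr0 mul0r.
move=> a S T /[!inE] -[linS [MS bS]] [linT [MT bT]]; split.
  move=> b x y; rewrite !fctE linS linT !scalerDr addrACA !scalerA.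
  by rewrite (mulrC a b).
exists (`|a| * MS + MT) => x; rewrite !fctE mulrDl.
rewrite (le_trans (ler_normD _ _))// lerD// normrZ -mulrA ler_wpM2l//.
Qed.

HB.instance Definition _ :=
  GRing.isSubmodClosed.Build R (X -> Y) bounded_operator
    bounded_operator_submod_closed.
HB.instance Definition _ := [SubChoice_isSubLmodule of Bop by <:].

Definition Bop_norm (T : Bop) : R := sup [set `|T x| | x in unit_ball X].

Lemma Bop_norm_has_sup (T : Bop) : has_sup [set `|T x| | x in unit_ball X].
Proof.
split; first by exists `|T 0|, 0; rewrite // /unit_ball/= normr0.
case: T => T /= /set_mem[_ [M bT]]; exists `|M| => _ [x x1 <-].
rewrite (le_trans (bT x))// (le_trans (ler_norm _))// normrM.
by rewrite normr_id ler_piMr.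
Qed.

Lemma le_Bop_norm (T : Bop) x : `|T x| <= Bop_norm T * `|x|.
Proof.
have [->|x0] := eqVneq x 0; first by rewrite linear0 !normr0 mulr0.
rewrite -ler_pdivrMr ?normr_gt0//.
have -> : `|T x| / `|x| = `|T (`|x|^-1 *: x)|.
  by rewrite linearZ normrZ normfV normr_id mulrC.
apply: ub_le_sup; first by case: (Bop_norm_has_sup T).
exists (`|x|^-1 *: x) => //.
by rewrite /unit_ball/= normrZ normfV normr_id mulVf// normr_eq0.
Qed.

Lemma Bop_norm_ge0 (T : Bop) : 0 <= Bop_norm T.
Proof.
apply: ub_le_sup; first by case: (Bop_norm_has_sup T).
by exists 0; rewrite /unit_ball/= ?linear0 normr0.
Qed.

Lemma Bop_norm_le (T : Bop) M :
  (forall x, `|x| <= 1 -> `|T x| <= M) -> Bop_norm T <= M.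
Proof.
move=> TM; apply: ge_sup; first by case: (Bop_norm_has_sup T).
by move=> _ [x x1 <-]; exact: TM.
Qed.

Lemma ler_Bop_normD (S T : Bop) : Bop_norm (S + T) <= Bop_norm S + Bop_norm T.
Proof.
apply: Bop_norm_le => x x1; rewrite (le_trans (ler_normD _ _))//.
by rewrite lerD// (le_trans (le_Bop_norm _ _))// ler_piMr// Bop_norm_ge0.
Qed.

Lemma ler_Bop_normZ (a : R) (T : Bop) : Bop_norm (a *: T) <= `|a| * Bop_norm T.
Proof.
apply: Bop_norm_le => x x1; rewrite normrZ ler_wpM2l//.
by rewrite (le_trans (le_Bop_norm _ _))// ler_piMr// Bop_norm_ge0.
Qed.

Lemma Bop_normZ (a : R) (T : Bop) : Bop_norm (a *: T) = `|a| * Bop_norm T.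
Proof.
have [->|a0] := eqVneq a 0.
  apply/eqP; rewrite eq_le ler_Bop_normZ.
  by rewrite normr0 mul0r Bop_norm_ge0.
apply/eqP; rewrite eq_le ler_Bop_normZ/= -ler_pdivlMl ?normr_gt0//.
by rewrite -normfV -{1}[T](scalerK a0) ler_Bop_normZ.
Qed.

Lemma Bop_norm_eq0 (T : Bop) : Bop_norm T = 0 -> T = 0.
Proof.
move=> T0; apply/val_inj/funext => x; apply/eqP.
by rewrite -normr_le0 (le_trans (le_Bop_norm _ _))// T0 mul0r.
Qed.

HB.instance Definition _ := Lmodule_isNormed.Build R Bop
  ler_Bop_normD Bop_normZ Bop_norm_eq0.

End bounded_operators.

Section dual.
Context (R : realType) (Y : normedModType R).

Definition dual := Bop Y R^o.

(* the weak-star topology: initial for the inclusion of the dual in the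
   product space of all scalar functions *)
Definition weak_star :=
  initial_topology (fun f : dual => (f : Y -> R^o) : {ptws Y -> R^o}).

End dual.

HB.instance Definition _ (R : realType) (Y : normedModType R) :=
  NormedModule.on (dual Y).
HB.instance Definition _ (R : realType) (Y : normedModType R) :=
  Topological.on (weak_star Y).

(** * Extreme points and property quasi-beta *)

Definition extreme_point (R : realType) (V : lmodType R) (C : set V) (e : V) :=
  C e /\ forall (x y : V) (t : R), C x -> C y -> 0 < t < 1 ->
    e = t *: x + (1 - t) *: y -> x = e /\ y = e.

(* [ereal_sup] rather than [sup], which is 0 on unbounded sets *)
Definition property_quasi_beta (R : realType) (Y : normedModType R) :=
  exists (A : set (dual Y)) (sigma : dual Y -> Y) (rho : dual Y -> R),
    [/\ A `<=` unit_sphere (dual Y),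
        (forall f, A f -> unit_sphere Y (sigma f)),
        (forall f, A f -> f (sigma f) = 1),
        (forall f g, A f -> A g -> f <> g -> `|g (sigma f)| <= rho f < 1) &
        (forall e, extreme_point (unit_ball (dual Y)) e ->
           exists (Ae : set (dual Y)) (t : R),
             [/\ Ae `<=` A, `|t| = 1,
                 closure (Ae : set (weak_star Y)) (t *: e) &
                 (ereal_sup [set (rho f)%:E | f in Ae] < 1)%E])].

(** * Norm attainment and Birkhoff-James orthogonality *)

Section bhatia_semrl.
Context (R : realType).

Definition bj_orth (X : normedModType R) (x y : X) :=
  forall l : R, `|x| <= `|x + l *: y|.

Definition strong_bj_orth (X : normedModType R) (x y : X) :=
  forall l : R, l <> 0 -> `|x| < `|x + l *: y|.

Context (X Y : normedModType R).

Definition attaining_set (T : Bop X Y) : set X :=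
  [set x | unit_sphere X x /\ `|T x| = `|T|].

Definition norm_attaining : set (Bop X Y) :=
  [set T | attaining_set T !=set0].

Definition adjusted_BS : set (Bop X Y) :=
  [set T | norm_attaining T /\
    forall S : Bop X Y, strong_bj_orth T S ->
      exists2 x0, attaining_set T x0 & bj_orth (T x0) (S x0)].

End bhatia_semrl.

Arguments norm_attaining {R} X Y _.
Arguments adjusted_BS {R} X Y _.

(** * The space L_1[0,1] *)

(** Functions on the line taken modulo the restriction of Lebesgue measure to
    [0, 1]: values outside [0, 1] are irrelevant. *)
Definition lebesgue01 (R : realType) : {measure set (measurableTypeR R) -> \bar R} :=
  mrestr lebesgue_measure (measurable_itv `[0%R : R, 1%R]).

Definition L1_01 (R : realType) : normedModType R :=
  LspaceType1 (lebesgue01 R).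

(* Main.v *)
(* The proof combines four ideas.
   (1) Lindenstrauss: perturbing [T : X -> Y] by a rapidly decreasing sequence of
   rank-one operators gives [V] such that the functionals [z] in the dual ball
   with [|z o V| = |V|] are exactly those satisfying countably many conditions
   [|z (y_n)| >= c_n]; they form a weak-star closed extremal set, which contains
   an extreme point [e] (Krein-Milman).
   (2) By quasi-beta, [e] up to sign is a limit of functionals [f] in [A] with
   [rho f <= r < 1], so some [f0] among them nearly attains [|V|].  Replacing
   [f0 o V] by a functional [psi] close to [(1 + h) (f0 o V)], through a rank-one
   perturbation in the direction [sigma f0], makes [f0] the only element of [A]
   that nearly attains the norm of the new operator [W].
   (3) Then the norm of [W + l S] equals [|f0 o (W + l S)|] for small [l], and the
   adjusted Bhatia-Semrl property of [W] follows from that of [psi = f0 o W].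
   (4) On an [L_1] space, functionals are densities [g] (Radon-Nikodym).  Pushing
   [|g|] up to a constant [M] where it is nearly maximal yields such a [psi]:
   if [psi] is strongly orthogonal to [h], then [h] takes values of both signs on
   the convex set of norm-one vectors where [psi] equals [M]. *)

From HB Require Import structures.
Require Import Defs.
From mathcomp Require Import all_boot all_order all_algebra.
From mathcomp Require Import all_classical all_reals all_analysis.
From mathcomp Require Import measurable_realfun.
From mathcomp Require Import ring lra.

Set Implicit Arguments.
Unset Strict Implicit.
Unset Printing Implicit Defensive.

Import Order.TTheory GRing.Theory Num.Theory.
Import numFieldNormedType.Exports.

Local Open Scope classical_set_scope.
Local Open Scope ring_scope.

(** * Hahn-Banach theorem *)

Section sublinear.
Context (R : realType) (V : lmodType R).

Definition sublinear (p : V -> R) :=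
  (forall x y, p (x + y) <= p x + p y) /\
  (forall a x, 0 < a -> p (a *: x) <= a * p x).

Lemma sublinear0 p : sublinear p -> p 0 = 0.
Proof.
move=> [_ pZ]; have := pZ 2 0 (ltr0Sn _ _); have := pZ 2^-1 0.
rewrite !scaler0 invr_gt0 => /(_ (ltr0Sn _ _)) h1 h2; lra.
Qed.

Lemma sublinearZ p a x : sublinear p -> 0 <= a -> p (a *: x) = a * p x.
Proof.
move=> sp; rewrite le_eqVlt => /predU1P[<-|a0].
  by rewrite scale0r mul0r sublinear0.
apply/eqP; rewrite eq_le sp.2//= -ler_pdivlMl// -{1}[x](scalerK (lt0r_neq0 a0)).
by apply: sp.2; rewrite invr_gt0.
Qed.

Lemma sublinear_ge p x : sublinear p -> - p (- x) <= p x.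
Proof.
by move=> sp; have := sp.1 x (- x); rewrite subrr sublinear0// => h; lra.
Qed.

(** The bound [b] keeps the infimum real. The members [g i] need not be compared one by one: this
    covers both the family in [t] of [sublinear_shrink] and chains in Zorn's lemma. *)
Lemma inf_sublinear (I : Type) (i0 : I) (g : I -> V -> R) (b : V -> R) :
  (forall i x, b x <= g i x) ->
  (forall i j x y, exists k, g k (x + y) <= g i x + g j y) ->
  (forall i a x, 0 < a -> exists k, g k (a *: x) <= a * g i x) ->
  sublinear (fun x => inf (range (g ^~ x))) /\
  forall i x, inf (range (g ^~ x)) <= g i x.
Proof.
move=> gb gD gZ.
have lb x : has_lbound (range (g ^~ x)) by exists (b x) => _ [i _ <-].
have ne x : range (g ^~ x) !=set0 by exists (g i0 x), i0.
have le i x : inf (range (g ^~ x)) <= g i x by apply: ge_inf => //; exists i.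
split=> //; split=> [x y|a x a0].
  rewrite -lerBlDl; apply: lb_le_inf => // _ [j _ <-].
  rewrite lerBlDl -lerBlDr; apply: lb_le_inf => // _ [i _ <-].
  by rewrite lerBlDr; have [k] := gD i j x y; exact/le_trans/le.
rewrite -ler_pdivrMl//; apply: lb_le_inf => // _ [i _ <-].
by rewrite ler_pdivrMl//; have [k] := gZ i a x a0; exact/le_trans/le.
Qed.

(* [q x] is the infimum of [p (x + t *: y) - t * p y] over [t >= 0]; for a
   minimal [p] it equals [p x], which makes [p] additive *)
Lemma sublinear_shrink p y : sublinear p ->
  exists q, [/\ sublinear q, forall x, q x <= p x &
    forall x, q x <= p (x + y) - p y].
Proof.
move=> sp; pose g (t : {nonneg R}) x := p (x + t%:num *: y) - t%:num * p y.
have [|||sq qg] := @inf_sublinear _ 0%:nng g (fun x => - p (- x)).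
- move=> t x; rewrite /g lerBrDl.
  have := sp.1 (x + t%:num *: y) (- x); rewrite addrAC subrr add0r.
  by rewrite sublinearZ// => h; lra.
- move=> s t x z; exists (s%:num + t%:num)%:nng; rewrite /g /=.
  have := sp.1 (x + s%:num *: y) (z + t%:num *: y).
  by rewrite addrACA -scalerDl => h; lra.
- move=> t a x a0; exists ((PosNum a0)%:num * t%:num)%:nng; rewrite /g/=.
  by have := sp.2 a (x + t%:num *: y) a0; rewrite scalerDr scalerA => h; lra.
exists (fun x => inf (range (g^~ x))); split=> //.
  move=> x; apply: le_trans (qg 0%:nng x) _.
  by rewrite /g/= scale0r addr0 mul0r subr0.
by move=> x; apply: le_trans (qg 1%:nng x) _; rewrite /g/= scale1r mul1r.
Qed.

(** Zorn's lemma for the reversed pointwise order: a chain is bounded by its infimum, finite because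
    [- p0 (- x) <= - p (- x) <= p x] for sublinear [p] below [p0]. *)
Lemma minimal_sublinear p0 : sublinear p0 ->
  exists2 p, sublinear p /\ (forall x, p x <= p0 x) &
    forall q, sublinear q -> (forall x, q x <= p x) -> q = p.
Proof.
move=> sp0; pose S := {p : V -> R | sublinear p /\ forall x, p x <= p0 x}.
pose s0 : S := exist _ p0 (conj sp0 (fun x => lexx _)).
have [|||A Atot|] := @Zorn S (fun p q => `[< forall x, sval q x <= sval p x >]).
- by move=> p; apply/asboolP.
- move=> p q r /asboolP pq /asboolP qr; apply/asboolP => x.
  exact: le_trans (qr x) (pq x).
- move=> [p hp] [q hq] /asboolP/= pq /asboolP/= qp; apply/eq_exist/funext => x.
  by apply/eqP; rewrite eq_le pq qp.
- have [[a Aa]|A0] := pselect (A !=set0); last first.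
    by exists s0 => s As; case: A0; exists s.
  pose g (i : {s : S | A s}) := sval (sval i).
  have [|||sq qg] := @inf_sublinear _ (exist _ a Aa) g (fun x => - p0 (- x)).
  + move=> [[p [sp pp0]] Ap] x; rewrite /g/=.
    by rewrite (le_trans _ (sublinear_ge _ sp))// lerN2.
  + move=> i j x y.
    wlog ij : i j x y / forall z, g i z <= g j z.
      move=> wl; have /orP[/asboolP h|/asboolP h] : `[<forall z, g i z <= g j z>] || `[<forall z, g j z <= g i z>].
        by have [h|h] := Atot _ _ (proj2_sig i) (proj2_sig j); rewrite h ?orbT.
      * exact: wl.
      * by rewrite addrC [g i x + _]addrC; apply: wl.
    exists i; rewrite (le_trans ((proj2_sig (sval i)).1.1 x y))// lerD2l.
    exact: ij.
  + by move=> i b x b0; exists i; exact: (proj2_sig (sval i)).1.2.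
  have qp0 x : inf (range (g^~ x)) <= p0 x.
    by rewrite (le_trans (qg (exist _ a Aa) x))//; exact: (proj2_sig a).2.
  exists (exist _ (fun x => inf (range (g^~ x))) (conj sq qp0) : S) => s As.
  apply/asboolP => x /=.
  exact: (qg (exist _ s As)).
- move=> [p [sp pp0]] pmin; exists p => // q sq qp.
  have qp0 x : q x <= p0 x by rewrite (le_trans (qp x)).
  have /(congr1 sval) := pmin (exist _ q (conj sq qp0) : S) (asboolT qp).
  by [].
Qed.

(** By minimality the function shrunk along [y] is [p] itself, so [p x + p y <= p (x + y)]. Thus [p]
    is additive, hence odd, which settles negative scalars. *)
Lemma minimal_sublinear_linear p : sublinear p ->
  (forall q, sublinear q -> (forall x, q x <= p x) -> q = p) ->
  linear (p : V -> R^o).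
Proof.
move=> sp pmin.
have pD x y : p (x + y) = p x + p y.
  have [q [sq qp qpy]] := sublinear_shrink y sp.
  by apply/eqP; rewrite eq_le sp.1/= -lerBrDr -{1}(pmin q).
have pN x : p (- x) = - p x.
  by apply/eqP; rewrite -addr_eq0 -pD addNr sublinear0.
move=> a x y; rewrite pD; congr (_ + _).
have [a0|a0] := leP 0 a; first exact: sublinearZ.
by rewrite -[a]opprK scaleNr pN sublinearZ ?oppr_ge0 1?ltW// scaleNr.
Qed.

End sublinear.

(** * The dual unit ball and norming functionals *)

Section dual_unit_ball.
Context (R : realType) (Y : normedModType R).

Lemma Bop_apply_le (X Z : normedModType R) (T : Bop X Z) x :
  `|T x| <= `|T| * `|x|.
Proof. exact: le_Bop_norm. Qed.

(** The dual unit ball as a set of plain functions, so that it lives in the product topology of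
    Tychonoff's theorem. *)
Definition functional_ball : set {ptws Y -> R^o} :=
  [set f | linear (f : Y -> R^o) /\ forall y, `|f y| <= `|y|].

Lemma functional_ball_dual f : functional_ball f ->
  exists2 g : dual Y, (g : Y -> R^o) = f & unit_ball (dual Y) g.
Proof.
move=> [lf f1].
have fb : f \in @bounded_operator R Y R^o.
  by rewrite inE; split=> //; exists 1 => x; rewrite mul1r f1.
exists (MkBop fb : dual Y) => //; rewrite /unit_ball/=.
by apply: Bop_norm_le => x x1; rewrite (le_trans (f1 x)).
Qed.

Lemma dual_functional_ball (g : dual Y) : unit_ball (dual Y) g ->
  functional_ball (g : Y -> R^o).
Proof.
move=> g1; split=> [a x y|y]; first by rewrite linearP.
by rewrite (le_trans (Bop_apply_le g y))// ler_piMl.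
Qed.

(** A linear functional below the norm shrunk along [y] is at most [- |y|] at [- y], hence at least
    [|y|] at [y]. *)
Lemma hahn_banach_norming (y : Y) :
  exists2 f, functional_ball f & f y = `|y|.
Proof.
have sn : sublinear (fun x : Y => `|x|).
  split=> [|a x a0]; first exact: ler_normD.
  by rewrite normrZ gtr0_norm.
have [q [sq qn qy]] := sublinear_shrink y sn.
have [p [sp pq] /(minimal_sublinear_linear sp) lp] := minimal_sublinear sq.
have pN x : p (- x) = - p x.
  by have := lp (-1) x 0; rewrite addr0 sublinear0// addr0 !scaleN1r.
have pn x : p x <= `|x| by rewrite (le_trans (pq x)).
exists p; first (split=> // x).
  rewrite ler_norml pn andbT lerNl -pN (le_trans (pn _))//.
  by rewrite normrN.
apply/eqP; rewrite eq_le pn/= -lerN2 -pN (le_trans (pq _))//.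
by rewrite (le_trans (qy _))// addNr normr0 sub0r.
Qed.

End dual_unit_ball.

(** * Extreme points of the dual ball *)

Section krein_milman.
Context (R : realType) (Y : normedModType R).
Local Notation W := {ptws Y -> R^o}.

Lemma ptws_eval_continuous (y : Y) : continuous (fun f : W => f y).
Proof. exact: proj_continuous. Qed.

Lemma functional_ball_closed : closed (@functional_ball R Y).
Proof.
have -> : @functional_ball R Y =
    \bigcap_(i : R * Y * Y)
      (fun f : W => f (i.1.1 *: i.1.2 + i.2) - (i.1.1 *: f i.1.2 + f i.2)) @^-1` [set 0]
    `&` \bigcap_(y : Y) (fun f : W => f y) @^-1` `[- `|y|, `|y|].
  apply/seteqP; split=> f [lf f1]; split.
  - by move=> [[a x] y] _ /=; rewrite lf subrr.
  - by move=> y _; rewrite /= in_itv/= -ler_norml.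
  - by move=> a x y; apply/eqP; rewrite -subr_eq0; apply/eqP/(lf (a, x, y)).
  - by move=> y; rewrite ler_norml; have := f1 y I; rewrite /= in_itv.
apply: closedI; apply: closed_bigI.
- move=> [[a x] y] _; apply: closed_comp; last exact: closed_eq.
  move=> f _.
  have ev z := @ptws_eval_continuous z f.
  exact: (@cvgB _ _ _ (nbhs f) _ _ _ _ _ (ev _)
    (@cvgD _ _ _ (nbhs f) _ _ _ _ _ (@cvgZl_tmp _ _ _ (nbhs f) _ a _ _ (ev x)) (ev y))).
- move=> y _; apply: closed_comp; last exact: itv_closed.
  by move=> f _; exact: ptws_eval_continuous.
Qed.

(** Banach-Alaoglu: a closed subset of the product of the segments [[- |y|, |y|]]. *)
Lemma functional_ball_compact : compact (@functional_ball R Y).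
Proof.
have cK : compact [set f : W | forall y, `[(- `|y|)%R, `|y|]%classic (f y)].
  apply: (@tychonoff Y (fun=> R^o) (fun y => `[(- `|y|)%R, `|y|]%classic)) => y.
  exact: segment_compact.
apply: (subclosed_compact functional_ball_closed cK) => f [_ f1] y.
by rewrite /= in_itv/= -ler_norml.
Qed.

Definition extremal_subset (V : lmodType R) (K F : set V) :=
  forall a b t, K a -> K b -> 0 < t < 1 -> F (t *: a + (1 - t) *: b) ->
    F a /\ F b.

(** The sets [F0] minus [U] form a filter base, and its cluster point in [F0] avoids each open [U].
    Used for Zorn chains and to satisfy countably many conditions at once. *)
Lemma compact_chain_setD_neq0 (T : topologicalType) (F0 : set T) (C : set (set T)) :
  compact F0 -> F0 !=set0 -> total_on C subset ->
  (forall U, C U -> open U /\ F0 `\` U !=set0) ->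
  closed F0 -> F0 `\` \bigcup_(U in C) U !=set0.
Proof.
move=> cF0 F0n Ctot Cop clF0.
have [[U0 CU0]|C0] := pselect (C !=set0); last first.
  by have [x F0x] := F0n; exists x; split=> // -[U CU]; case: C0; exists U.
pose G := filter_from C (fun U => F0 `\` U).
have GP : ProperFilter G.
  apply: filter_from_proper => [|U /Cop[]//].
  apply: filter_from_filter; first by exists U0.
  move=> U V CU CV; have [UV|VU] := Ctot _ _ CU CV.
    by exists V => // x [F0x nV]; split; split=> // /UV.
  by exists U => // x [F0x nU]; split; split=> // /VU.
have [|p [F0p Gp]] := cF0 G GP; first by exists U0 => // x [].
exists p; split=> // -[U CU Up].
have [||x [[_ nUx]]] := Gp (F0 `\` U) U; last by [].
  by exists U.
by apply: open_nbhs_nbhs; split=> //; exact: (Cop _ CU).1.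
Qed.

(** Krein-Milman: a minimal closed nonempty extremal subset is a single point, since maximizing an
    evaluation would otherwise give a smaller one; that point is extreme. *)
Lemma extremal_subset_extreme_point (F0 : set W) :
  F0 `<=` @functional_ball R Y -> closed F0 -> F0 !=set0 ->
  extremal_subset (@functional_ball R Y : set (Y -> R^o)) F0 ->
  exists2 e : dual Y, extreme_point (unit_ball (dual Y)) e & F0 (e : Y -> R^o).
Proof.
move=> F0K clF0 F0n exF0.
have cF0 : compact F0 by exact: subclosed_compact clF0 functional_ball_compact F0K.
(* the sets [F0 `\` U] below are the closed nonempty extremal subsets of [F0] *)
pose P (U : set W) := [/\ open U, F0 `\` U !=set0 &
  extremal_subset (@functional_ball R Y : set (Y -> R^o)) (F0 `\` U)].
have [C CP Ctot|U [[Uop [f [F0f nUf]] exU] Umax]] := @Zorn_bigcup W P.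
  split.
  - by apply: bigcup_open => U /CP[].
  - by apply: compact_chain_setD_neq0 => // U /CP[].
  - move=> a b t Ka Kb t01 [F0ab nUab].
    have [F0a F0b] := exF0 _ _ _ Ka Kb t01 F0ab.
    split; split=> // -[U CU Ux].
      have [_ _ /(_ a b t Ka Kb t01)[|[]//]] := CP _ CU.
      by split=> // Uab; apply: nUab; exists U.
    have [_ _ /(_ a b t Ka Kb t01)[|_ []//]] := CP _ CU.
    by split=> // Uab; apply: nUab; exists U.
have Esingle g : F0 g -> ~ U g -> g = f.
  move=> F0g nUg; apply/funext => y; apply: contrapT => gfy.
  have cE : compact (F0 `\` U).
    apply: (subclosed_compact _ cF0); last by move=> ? [].
    by rewrite setDE; apply: closedI => //; exact: open_closedC.
  have [||m /set_mem[F0m nUm] mmax] := @compact_EVT_max W R (fun h => h y) _ _ cE.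
  - by exists f.
  - by apply: continuous_subspaceT; exact: ptws_eval_continuous.
  (* Only the maximizers of the evaluation at [y] remain outside [V]; they cannot include both [f]
     and [g], which differ at [y]. *)
  pose V := U `|` [set h : W | h y != m y].
  have VE h : (F0 `\` V) h <-> (F0 `\` U) h /\ h y = m y.
    split=> [[F0h /not_orP[nUh /negP/negPn/eqP]]//|[[F0h nUh] hm]].
    by split=> // -[//|/=]; rewrite hm eqxx.
  apply: (Umax V).
    split=> [h|VU]; first by left.
    have nV h : ~ U h -> h y = m y.
      by move=> nUh; apply/eqP/negPn/negP => hm; apply/nUh/VU; right.
    by apply: gfy; rewrite !nV.
  split.
  - apply: openU => //.
    apply: (@open_comp _ _ (fun h : W => h y) [set x : R | x != m y]);
      last exact: open_neq.
    by move=> h _; exact: ptws_eval_continuous.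
  - by exists m; apply/VE.
  - move=> a b t Ka Kb t01 /VE[Eab abm].
    have [Ea Eb] := exU _ _ _ Ka Kb t01 Eab.
    have am := mmax _ (mem_set Ea); have bm := mmax _ (mem_set Eb).
    have {}abm : t * a y + (1 - t) * b y = m y by [].
    move/andP: t01 => [t0 t1].
    by split; apply/VE; split=> //; nra.
have [e ef e1] := functional_ball_dual (F0K _ F0f).
exists e; last by rewrite ef.
split=> // x y t x1 y1 t01 exy.
have [|[F0x nUx] [F0y nUy]] := exU (x : Y -> R^o) (y : Y -> R^o) t
   (dual_functional_ball x1) (dual_functional_ball y1) t01.
  suff -> : t *: (x : Y -> R^o) + (1 - t) *: (y : Y -> R^o) = f by [].
  by rewrite -ef exy.
by split; apply/val_inj => /=; rewrite ef; exact: Esingle.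
Qed.

End krein_milman.

(** * Lindenstrauss perturbations *)

Section operator_norm.
Context (R : realType).

Lemma Bop_norm_leP (X Y : normedModType R) (T : Bop X Y) M :
  0 <= M -> (forall x, `|T x| <= M * `|x|) -> `|T| <= M.
Proof.
move=> M0 TM; apply: Bop_norm_le => x x1.
by rewrite (le_trans (TM x))// ler_piMr.
Qed.

Lemma Bop_norm_adherent (X Y : normedModType R) (T : Bop X Y) e :
  0 < e -> exists2 x, `|x| <= 1 & `|T| - e < `|T x|.
Proof.
move=> e0; have [_ [x x1 <-] Tx] := sup_adherent e0 (Bop_norm_has_sup T).
by exists x.
Qed.

Lemma Bop_comp_bounded (X Y Z : normedModType R) (S : Bop Y Z) (T : Bop X Y) :
  S \o T \in @bounded_operator R X Z.
Proof.
rewrite inE; split=> [a x y|]; first by rewrite /= !linearP.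
exists (`|S| * `|T|) => x /=.
by rewrite (le_trans (Bop_apply_le _ _))// -mulrA ler_wpM2l// Bop_apply_le.
Qed.

Definition Bop_comp (X Y Z : normedModType R) (S : Bop Y Z) (T : Bop X Y) :
  Bop X Z := MkBop (Bop_comp_bounded S T).

Lemma Bop_comp_norm (X Y Z : normedModType R) (S : Bop Y Z) (T : Bop X Y) :
  `|Bop_comp S T| <= `|S| * `|T|.
Proof.
apply: Bop_norm_leP => [|x]; first by rewrite mulr_ge0.
by rewrite (le_trans (Bop_apply_le S (T x)))// -mulrA ler_wpM2l// Bop_apply_le.
Qed.

Lemma rank_one_bounded (X Y : normedModType R) (f : Bop X R^o) (y : Y) :
  (fun x => (f x : R) *: y) \in @bounded_operator R X Y.
Proof.
rewrite inE; split=> [a u v|]; first by rewrite linearP scalerDl scalerA.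
by exists (`|f| * `|y|) => x; rewrite normrZ mulrAC ler_wpM2r// Bop_apply_le.
Qed.

Definition rank_one (X Y : normedModType R) (f : Bop X R^o) (y : Y) : Bop X Y :=
  MkBop (rank_one_bounded f y).

Lemma rank_one_norm (X Y : normedModType R) (f : Bop X R^o) (y : Y) :
  `|rank_one f y| <= `|f| * `|y|.
Proof.
apply: Bop_norm_leP => [|x]; first by rewrite mulr_ge0.
by rewrite normrZ mulrAC ler_wpM2r// Bop_apply_le.
Qed.

Lemma unit_ball_comp_le (X Y Z : normedModType R) (S : Bop Y Z) (T : Bop X Y) :
  `|S| <= 1 -> `|Bop_comp S T| <= `|T|.
Proof. by move=> S1; rewrite (le_trans (Bop_comp_norm _ _))// ler_piMl. Qed.

Lemma Bop_compB (X Y Z : normedModType R) (S : Bop Y Z) (T U : Bop X Y) :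
  Bop_comp S (T - U) = Bop_comp S T - Bop_comp S U.
Proof. by apply/val_inj/funext => x; exact: linearB. Qed.

Lemma Bop_compD (X Y Z : normedModType R) (S : Bop Y Z) (T U : Bop X Y) :
  Bop_comp S (T + U) = Bop_comp S T + Bop_comp S U.
Proof. by apply/val_inj/funext => x; exact: linearD. Qed.

Lemma Bop_compZ (X Y Z : normedModType R) (S : Bop Y Z) a (T : Bop X Y) :
  Bop_comp S (a *: T) = a *: Bop_comp S T.
Proof. by apply/val_inj/funext => x; exact: linearZ. Qed.

(** The same rate [e] in hypothesis and conclusion keeps the distance from the limit to each term
    explicit, as the iteration below requires. *)
Lemma Bop_cauchy_limit (X : normedModType R) (Y : completeNormedModType R)
    (u : nat -> Bop X Y) (e : nat -> R) :
  (forall d, 0 < d -> exists n, e n < d) ->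
  (forall n k, `|u (n + k)%N - u n| <= e n) ->
  exists V, forall n, `|V - u n| <= e n.
Proof.
move=> e_small ue.
have e0 n : 0 <= e n by rewrite (le_trans _ (ue n 0%N)).
(* Uniqueness of limits along indices with [e n] small; it yields the linearity of the pointwise
   limit. *)
have uniq x (y z : Y) C D : (forall n, `|y - u n x| <= e n * C) ->
    (forall n, `|z - u n x| <= e n * D) -> y = z.
  move=> yC zD; apply/eqP; rewrite -subr_eq0 -normr_le0; apply/ler_addgt0Pl => d d0.
  rewrite addr0.
  have CD : 0 < `|C| + `|D| + 1 by rewrite ltr_wpDl// addr_ge0.
  have [n en] := e_small (d / (`|C| + `|D| + 1)) (divr_gt0 d0 CD).
  rewrite -(subrK (u n x) y) -addrA (le_trans (ler_normD _ _))// [in X in _ + X]distrC.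
  rewrite (le_trans (lerD (yC n) (zD n)))// -mulrDr.
  move: en; rewrite ltr_pdivlMr// => /ltW; apply: le_trans.
  rewrite ler_wpM2l// (le_trans (ler_norm _))// (le_trans (ler_normD _ _))//.
  by rewrite lerDl.
have ue' n k x : `|u (n + k)%N x - u n x| <= e n * `|x|.
  by rewrite (le_trans (Bop_apply_le (u (n + k)%N - u n) x))// ler_wpM2r.
have ex x : exists y, forall n, `|y - u n x| <= e n * `|x|.
  have cu : cvgn (fun n => u n x).
    apply/cauchy_cvgP/cauchy_exP => _/posnumP[d].
    have x1 : 0 < `|x| + 1 by rewrite ltr_wpDl.
    have [|n en] := e_small (d%:num / (`|x| + 1)); first by rewrite divr_gt0.
    exists (u n x), n => // m /= nm; rewrite -(subnKC nm) -ball_normE/= distrC.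
    rewrite (le_lt_trans (ue' _ _ _))//.
    move: en; rewrite ltr_pdivlMr//; apply: le_lt_trans.
    by rewrite ler_wpM2l// lerDl.
  exists (limn (fun n => u n x)) => n.
  have cv : (fun m => `|u m x - u n x|) @ \oo --> `|limn (fun n => u n x) - u n x|.
    by apply: cvg_norm; apply: cvgB => //; exact: cvg_cst.
  apply: (cvgr_to_le cv).
  by exists n => // m /= nm; rewrite -(subnKC nm) ue'.
pose V x := sval (cid (ex x)).
have VE x n : `|V x - u n x| <= e n * `|x| by rewrite /V; case: cid.
have Vb : V \in @bounded_operator R X Y.
  rewrite inE; split=> [a x y|].
    apply: (uniq (a *: x + y) _ _ `|a *: x + y| (`|a| * `|x| + `|y|)) => n //.
    rewrite linearP opprD addrACA -scalerBr (le_trans (ler_normD _ _))//.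
    by rewrite mulrDr lerD//; [rewrite normrZ mulrCA ler_wpM2l|]; rewrite ?VE.
  exists (e 0%N + `|u 0%N|) => x.
  rewrite -(subrK (u 0%N x) (V x)) (le_trans (ler_normD _ _))// mulrDl.
  by rewrite lerD ?VE ?Bop_apply_le.
by exists (MkBop Vb) => n; apply: Bop_norm_leP => // x; exact: VE.
Qed.

End operator_norm.

(** * Rank-one perturbations and their iteration *)

Section lindenstrauss.
Context (R : realType).

Lemma hahn_banach_unit_ball (Y : normedModType R) (y : Y) :
  exists2 f : dual Y, `|f| <= 1 & f y = `|y|.
Proof.
have [f fK fy] := hahn_banach_norming y.
by have [g gf g1] := functional_ball_dual fK; exists g; rewrite // gf.
Qed.

(** Here [N = |U|], [u = |U x|], [a1 = |U'|], [a2 = |V|], [a3 = |z o V|], [a4 = |z o U'|] and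
    [a5 = |z (U x)|]. The estimates lose [4 * c], plus [2 * h * N * c] from bounding [u ^+ 2] below;
    the equation on [c] makes the total [k * h * N]. *)
Lemma lindenstrauss_step_bound (N h k c u a1 a2 a3 a4 a5 : R) :
  0 < h -> 0 < N -> c * (2 * h * N + 4) = k * h * N -> N - c < u ->
  u + h * u ^+ 2 <= a1 -> a4 <= N + h * N * a5 -> a1 - c <= a2 -> a3 - c <= a4 ->
  a2 - c <= a3 -> h * N * (N - k) <= h * N * a5.
Proof.
move=> h0 N0 cE uN H1 H2 H3 H4 H5.
have H6 : N ^+ 2 - 2 * N * c <= u ^+ 2.
  have := sqr_ge0 (u - N); nra.
rewrite -(ler_pM2l h0) in H6.
have : h * N * (N - k) = h * (N ^+ 2 - 2 * N * c) - 4 * c.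
  by transitivity (h * N ^+ 2 - k * h * N); [ring|rewrite -cE; ring].
move=> ->; lra.
Qed.

(* With [f] norming [U x], adding a multiple of the rank-one operator
   [f (U _) *: U x] favours the functionals [z] for which [z (U x)] is large. *)
Lemma lindenstrauss_step (X Y : normedModType R) (U : Bop X Y) (k : R) :
  0 < k -> exists (U' : Bop X Y) (x : X) (c : R),
    [/\ 0 < c, `|U' - U| <= k, `|x| <= 1 &
      forall (V : Bop X Y) (z : dual Y), `|V - U'| <= c -> `|z| <= 1 ->
        `|V| - c <= `|Bop_comp z V| -> `|U| - k <= `|z (U x)|].
Proof.
move=> k0; have [U0|N0] := leP `|U| 0.
  exists U, 0, 1; split; rewrite ?subrr ?normr0//; first exact: ltW.
  by move=> V z _ _ _; rewrite (le_trans _ (normr_ge0 _))// lerBlDr add0r (le_trans U0)// ltW.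
set N := `|U| in N0 *.
(* The perturbation below has norm at most [h * N ^+ 2], that is, [k]. *)
pose h := k / N ^+ 2; have h0 : 0 < h by rewrite divr_gt0// exprn_gt0.
have hN : h * N ^+ 2 = k by rewrite /h divfK// expf_neq0// gt_eqF.
pose c := k * h * N / (2 * h * N + 4).
have hN0 : 0 < h * N by rewrite mulr_gt0.
have D0 : 0 < 2 * h * N + 4 by lra.
have c0 : 0 < c by rewrite /c divr_gt0// mulr_gt0// mulr_gt0.
have cE : c * (2 * h * N + 4) = k * h * N by rewrite /c divfK// gt_eqF.
have [x x1 Ux] := Bop_norm_adherent U c0.
have [f f1 fUx] := hahn_banach_unit_ball (U x).
pose U' := U + h *: rank_one (Bop_comp f U) (U x).
have fU : `|Bop_comp f U| <= N by exact: unit_ball_comp_le.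
have UxN : `|U x| <= N.
  by rewrite (le_trans (Bop_apply_le _ _))// ler_piMr.
exists U', x, c; split=> //.
  rewrite /U' addrAC subrr add0r normrZ gtr0_norm// -hN expr2.
  by rewrite ler_pM2l// (le_trans (rank_one_norm _ _))// ler_pM.
move=> V z VU' z1 zV.
have U'x : `|U x| + h * `|U x| ^+ 2 <= `|U'|.
  have -> : `|U x| + h * `|U x| ^+ 2 = `|U' x|.
    have -> : U' x = (1 + h * `|U x|) *: U x.
      rewrite scalerDl scale1r -scalerA -fUx; by [].
    have p0 : 0 <= 1 + h * `|U x| by rewrite addr_ge0// mulr_ge0// ltW.
    by rewrite normrZ ger0_norm// mulrDl mul1r expr2 mulrA.
  by rewrite (le_trans (Bop_apply_le _ _))// ler_piMr.
have zU' : `|Bop_comp z U'| <= N + h * N * `|z (U x)|.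
  rewrite Bop_compD Bop_compZ (le_trans (ler_normD _ _))// lerD//.
    exact: unit_ball_comp_le.
  rewrite normrZ gtr0_norm// -mulrA ler_pM2l//.
  apply: Bop_norm_leP => [|w]; first by rewrite mulr_ge0// ltW.
  rewrite /= linearZ normrZ mulrAC ler_wpM2r//.
  by rewrite (le_trans (Bop_apply_le (Bop_comp f U) w))// ler_wpM2r.
have VU'n : `|U'| - c <= `|V|.
  rewrite lerBlDl -lerBlDr (le_trans (lerB_dist _ _))//.
  by rewrite distrC.
have zVU' : `|Bop_comp z V| - c <= `|Bop_comp z U'|.
  rewrite lerBlDl -lerBlDr (le_trans (lerB_dist _ _))//.
  by rewrite -Bop_compB (le_trans (unit_ball_comp_le _ z1)).
have hNz := lindenstrauss_step_bound h0 N0 cE Ux U'x zU' VU'n zVU' zV.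
by rewrite (ler_pM2l hN0) in hNz.
Qed.

(** Each tolerance of the iteration is at most a quarter of the previous tolerance and of the
    previous [c]. So [V] is within twice the tolerance of [U n], hence within [c n] of [U n.+1], and
    the estimate of every step applies to [V]. The doubled tolerances are returned as [k]. *)
Lemma lindenstrauss_sequence (X : normedModType R) (Y : completeNormedModType R)
    (T : Bop X Y) (eps : R) : 0 < eps ->
  exists (V : Bop X Y) (U : nat -> Bop X Y) (x : nat -> X) (k c : nat -> R),
    [/\ `|V - T| <= eps,
        (forall n, [/\ 0 < c n, `|x n| <= 1 & `|V - U n| <= k n]),
        (forall d, 0 < d -> exists n, k n < d) &
        forall n (z : dual Y), `|z| <= 1 -> `|V| - c n <= `|Bop_comp z V| ->
          `|U n| - k n <= `|z (U n (x n))|].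
Proof.
move=> e0.
(* The total displacement is at most twice the first tolerance. *)
have e20 : 0 < eps / 2 by rewrite divr_gt0.
pose st := (Bop X Y * {posnum R})%type.
have ex (s : st) : exists r : st * X * R,
    [/\ `|r.1.1.1 - s.1| <= s.2%:num, `|r.1.2| <= 1, 0 < r.2,
      r.1.1.2%:num <= s.2%:num / 4 /\ r.1.1.2%:num <= r.2 / 4 &
      forall (V : Bop X Y) (z : dual Y), `|V - r.1.1.1| <= r.2 -> `|z| <= 1 ->
        `|V| - r.2 <= `|Bop_comp z V| -> `|s.1| - s.2%:num <= `|z (s.1 r.1.2)|].
  have [U' [x [c [c0 ? ? ?]]]] := @lindenstrauss_step X Y s.1 s.2%:num [gt0 of s.2%:num].
  have d0 : 0 < Num.min s.2%:num c / 4 by rewrite divr_gt0// lt_min c0 andbT.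
  exists (U', PosNum d0, x, c); split=> //=.
  by split; rewrite ler_pM2r// ge_min lexx ?orbT.
have [f fP] := choice ex.
pose s n := iter n (fun s => (f s).1.1) (T, PosNum e20).
pose k n := (s n).2%:num.
pose c n := (f (s n)).2.
pose U n := (s n).1.
have k0 n : 0 < k n by rewrite /k.
have c0 n : 0 < c n by have [] := fP (s n).
have kS n : k n.+1 <= k n / 4 /\ k n.+1 <= c n / 4 by have [] := fP (s n).
have US n : `|U n.+1 - U n| <= k n by have [] := fP (s n).
have UD n m : `|U (n + m)%N - U n| <= 2 * k n.
  elim: m n => [|m IH] n.
    by rewrite addn0 subrr normr0; have := k0 n; lra.
  rewrite addnS -addSn -(subrKA (U n.+1)) (le_trans (ler_normD _ _))//.
  by have := IH n.+1; have := US n; have := (kS n).1; have := k0 n; lra.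
have kn n : k n <= k 0%N / n.+1%:R.
  elim: n => [|n IH]; first by rewrite divr1.
  rewrite (le_trans (kS n).1)// ler_pdivrMr// mulrAC ler_pdivlMr//.
  move: IH; rewrite ler_pdivlMr// => IH.
  rewrite -(natr1 n.+1).
  have n0 : (0 : R) <= n%:R by [].
  have := k0 n; rewrite -(natr1 n) in IH *; nra.
have k_small d : 0 < d -> exists n, 2 * k n < d.
  move=> d0.
  have kd : 0 <= 2 * k 0%N / d by rewrite divr_ge0 ?(ltW d0)//; have := k0 0%N; lra.
  exists (Num.bound (2 * k 0%N / d)).
  have := archi_boundP kd; set n := Num.bound _; rewrite ltr_pdivrMr// => h.
  have := kn n; rewrite ler_pdivlMr// -natr1 => h2.
  have n0 : (0 : R) <= n%:R by [].
  have := k0 n; nra.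
have [V VU] := Bop_cauchy_limit k_small UD.
exists V, U, (fun n => (f (s n)).1.2), (fun n => 2 * k n), c; split=> //.
- by have := VU 0%N; rewrite /U /k/= mulrC divfK.
- by move=> n; split=> //; have [] := fP (s n).
- move=> n z z1 zV; have [_ _ _ _ /(_ V z) h] := fP (s n).
  have {}h : `|U n| - k n <= `|z (U n (f (s n)).1.2)|.
    apply: h => //; rewrite (le_trans (VU n.+1))//.
    have := (kS n).2; have := c0 n; rewrite /c; lra.
  by rewrite (le_trans _ h)// lerD2l lerN2; have := k0 n; lra.
Qed.

End lindenstrauss.

(** * Operators whose adjoint attains its norm at an extreme point *)

Section adjoint_attaining.
Context (R : realType).

Lemma Bop_comp_adherent (X Y : normedModType R) (V : Bop X Y) d : 0 < d ->
  exists2 z : dual Y, `|z| <= 1 & `|V| - d <= `|Bop_comp z V|.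
Proof.
move=> d0; have [w w1 Vw] := Bop_norm_adherent V d0.
have [f f1 fV] := hahn_banach_unit_ball (V w).
exists f => //; rewrite (le_trans (ltW Vw))// -[leLHS]normr_id -fV.
by rewrite (le_trans (Bop_apply_le (Bop_comp f V) w))// ler_piMr.
Qed.

(** In the dual ball, [F] is the set where [|z o V|] attains its maximum [|V|]. As a set of
    maximizers of a convex function it is extremal; as an intersection of closed conditions on
    single values it is closed and, by compactness, nonempty. *)
Lemma extreme_adjoint_attaining_dense (X : normedModType R)
    (Y : completeNormedModType R) (T : Bop X Y) (eps : R) : 0 < eps ->
  exists (V : Bop X Y) (e : dual Y),
    [/\ `|V - T| <= eps, extreme_point (unit_ball (dual Y)) e &
        `|Bop_comp e V| = `|V|].
Proof.
move=> e0; have [V [U [x [k [c [VT cxk k_small VU]]]]]] := lindenstrauss_sequence T e0.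
pose F : set {ptws Y -> R^o} := [set f | functional_ball f /\
  forall n, `|U n| - k n <= `|f (U n (x n)) : R|].
have c0 n : 0 < c n by have [] := cxk n.
(* The condition at [n] and two comparisons of [U n] with [V] cost [k n] each, hence [d / 3]. *)
have FV (z : dual Y) : F (z : Y -> R^o) -> `|V| <= `|Bop_comp z V|.
  move=> [[_ z1] zF]; apply/ler_addgt0Pl => d d0.
  have [|n kn] := k_small (d / 3); first by rewrite divr_gt0.
  have [_ xn Vn] := cxk n.
  have zV : `|z (V (x n))| <= `|Bop_comp z V|.
    by rewrite (le_trans (Bop_apply_le (Bop_comp z V) (x n)))// ler_piMr.
  have h1 : `|z (U n (x n))| - k n <= `|z (V (x n))|.
    rewrite lerBlDl -lerBlDr (le_trans (lerB_dist _ _))//.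
    rewrite -linearB (le_trans (z1 _))// distrC.
    by rewrite (le_trans (Bop_apply_le (V - U n) (x n)))// (le_trans _ Vn)// ler_piMr.
  have h2 : `|V| - k n <= `|U n|.
    by rewrite lerBlDl -lerBlDr (le_trans (lerB_dist _ _)).
  have := zF n; lra.
have VF (z : dual Y) : `|z| <= 1 -> `|V| <= `|Bop_comp z V| -> F (z : Y -> R^o).
  move=> z1 zV; split=> [|n]; first exact: dual_functional_ball.
  by apply: VU => //; rewrite (le_trans _ zV)// gerBl ltW.
have ev_open n : open [set f : {ptws Y -> R^o} | `|f (U n (x n)) : R| < `|U n| - k n].
  apply: (@open_comp _ _ (fun f : {ptws Y -> R^o} => `|f (U n (x n)) : R^o|)
    [set r : R | r < `|U n| - k n]); last exact: open_lt.
  move=> f _; apply: (@continuous_comp _ _ _ (fun f : {ptws Y -> R^o} => f (U n (x n)))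
    (fun r : R^o => `|r|)); first exact: ptws_eval_continuous.
  exact: norm_continuous.
(* The functionals violating one of the first [m] conditions. Those attaining [|V|] up to the least
   of the first [m] values of [c] lie outside. *)
pose C m : set {ptws Y -> R^o} := \bigcup_(n in [set n | (n < m)%N])
  [set f | `|f (U n (x n)) : R| < `|U n| - k n].
have F0 : F !=set0.
  have [|||||f [fK nf]] := @compact_chain_setD_neq0 {ptws Y -> R^o}
    (@functional_ball R Y) (range C).
  - exact: functional_ball_compact.
  - by have [f fK _] := hahn_banach_norming (0 : Y); exists f.
  - move=> _ _ [m _ <-] [n _ <-]; have [mn|nm] := leqP m n; [left|right].
      by move=> f [i /= im fi]; exists i => //=; exact: leq_trans mn.
    by move=> f [i /= im fi]; exists i => //=; exact: ltn_trans nm.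
  - move=> _ [m _ <-]; split; first by apply: bigcup_open => n _.
    have [d d0 dc] : exists2 d, 0 < d & forall n, (n < m)%N -> d <= c n.
      elim: m => [|m [d d0 dc]]; first by exists 1.
      exists (Num.min d (c m)); first by rewrite lt_min d0 c0.
      move=> n; rewrite ltnS leq_eqVlt => /predU1P[->|/dc dn].
        by rewrite ge_min lexx orbT.
      by rewrite ge_min dn.
    have [z z1 zV] := Bop_comp_adherent V d0.
    exists (z : Y -> R^o); split; first exact: dual_functional_ball.
    move=> [n /= nm]; apply/negP; rewrite -leNgt; apply: VU => //.
    by rewrite (le_trans _ zV)// lerD2l lerN2 dc.
  - exact: functional_ball_closed.
  - exists f; split=> // n; rewrite leNgt; apply/negP => fn; apply: nf.
    by exists (C n.+1); [exists n.+1|exists n => /=].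
have clF : closed F.
  have -> : F = @functional_ball R Y `&` \bigcap_n ~` [set f | `|f (U n (x n)) : R| < `|U n| - k n].
    apply/seteqP; split=> f [fK fn]; split=> // n.
      by move=> _ /=; apply/negP; rewrite -leNgt.
    by rewrite leNgt; apply/negP/(fn n I).
  apply: closedI; first exact: functional_ball_closed.
  by apply: closed_bigI => n _; exact: open_closedC.
have [||e eext eF] := @extremal_subset_extreme_point R Y F _ clF F0.
- by move=> f [].
(* Both [|a o V|] and [|b o V|] are at most [|V|], and their convex combination is at least [|V|],
   so both equal it. *)
- move=> a b t aK bK t01 abF.
  have [a' a'E a'1] := functional_ball_dual aK.
  have [b' b'E b'1] := functional_ball_dual bK.
  have := FV (t *: a' + (1 - t) *: b' : dual Y).
  have -> : ((t *: a' + (1 - t) *: b' : dual Y) : Y -> R^o) = t *: a + (1 - t) *: b.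
    by rewrite -a'E -b'E.
  move=> /(_ abF).
  have -> : Bop_comp (t *: a' + (1 - t) *: b' : dual Y) V =
     t *: Bop_comp a' V + (1 - t) *: Bop_comp b' V by apply/val_inj.
  move=> h; have := le_trans h (ler_normD _ _).
  have a'V := unit_ball_comp_le V a'1; have b'V := unit_ball_comp_le V b'1.
  move/andP: t01 => [t0 t1].
  rewrite !normrZ (gtr0_norm t0) gtr0_norm ?subr_gt0// => h2.
  by split; rewrite -?a'E -?b'E; apply: VF => //; nra.
- exists V, e; split=> //; apply/eqP; rewrite eq_le unit_ball_comp_le ?FV//.
  exact: eext.1.
Qed.

End adjoint_attaining.

(** * Operators into spaces with property quasi-beta *)

Section quasi_beta.
Context (R : realType).

Lemma normed_denseP (Z : normedModType R) (D : set Z) :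
  dense D <-> forall z e, 0 < e -> exists2 d, D d & `|d - z| <= e.
Proof.
split=> [dD z e e0|h O [z Oz] oO].
  have [|d [zd Dd]] := dD (ball z e) _ (ball_open z e).
    by exists z; exact: ballxx.
  by exists d => //; move: zd; rewrite -ball_normE/= distrC => /ltW.
have /nbhs_ballP[_/posnumP[e] eO] : nbhs z O by exact: open_nbhs_nbhs.
have [|d Dd dz] := h z (e%:num / 2); first by rewrite divr_gt0.
exists d; split=> //; apply: eO; rewrite -ball_normE/= distrC.
by rewrite (le_lt_trans dz)// ltr_pdivrMr// ltr_pMr// ltr1n.
Qed.

Lemma weak_star_closure_eval (Y : normedModType R) (A : set (dual Y)) (z : dual Y)
    (y : Y) d :
  closure (A : set (weak_star Y)) z -> 0 < d ->
  exists2 f, A f & `|f y - z y| < d.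
Proof.
move=> clz d0.
have ev : {for (z : weak_star Y), continuous
    (fun f : weak_star Y => ((f : dual Y) : Y -> R^o) y)}.
  apply: (@continuous_comp (weak_star Y) {ptws Y -> R^o} R^o
    (fun f : weak_star Y => ((f : dual Y) : Y -> R^o) : {ptws Y -> R^o})
    (fun f => f y)).
    exact: initial_continuous.
  exact: ptws_eval_continuous.
have [f [Af fz]] := clz _ (ev _ (nbhsx_ballx (z y) d d0)).
by exists f => //; move: fz; rewrite /= -ball_normE/= distrC.
Qed.

Lemma ereal_sup_lt1 (T : Type) (rho : T -> R) (A : set T) :
  (ereal_sup [set (rho f)%:E | f in A] < 1)%E ->
  exists r, [/\ 0 <= r, r < 1 & forall f, A f -> rho f <= r].
Proof.
move=> h; have [[f0 Af0]|A0] := pselect (A !=set0); last first.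
  by exists 0; split=> // f Af; case: A0; exists f.
have ub f : A f -> ((rho f)%:E <= ereal_sup [set (rho f)%:E | f in A])%E.
  by move=> Af; apply: ereal_sup_ubound; exists f.
move: h ub; case: ereal_sup => [s||]//; last first.
  by move=> _ /(_ f0 Af0).
rewrite lte_fin => s1 ub; exists (Num.max 0 s); split.
- by rewrite le_max lexx.
- by rewrite gt_max ltr01.
- by move=> f /ub; rewrite lee_fin le_max => ->; rewrite orbT.
Qed.

Definition norming_set (Y : normedModType R) (A : set (dual Y)) :=
  forall y d, 0 < d -> exists2 f, A f & `|y| - d < `|f y|.

Lemma norming_set_le (X Y : normedModType R) (A : set (dual Y)) (T : Bop X Y) M :
  0 <= M -> norming_set A -> (forall f, A f -> `|Bop_comp f T| <= M) -> `|T| <= M.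
Proof.
move=> M0 nA fM; apply: Bop_norm_leP => // x; apply/ler_addgt0Pl => d d0.
have [f Af fTx] := nA (T x) d d0.
rewrite -lerBlDl (le_trans (ltW fTx))//.
by rewrite (le_trans (Bop_apply_le (Bop_comp f T) x))// ler_wpM2r// fM.
Qed.

(** The functionals of the dual ball with value [|y|] at [y] form a nonempty closed extremal set.
    One of them is therefore extreme, and up to sign a weak-star limit of elements of [A]. *)
Lemma extreme_norming (Y : normedModType R) (A : set (dual Y)) :
  (forall e, extreme_point (unit_ball (dual Y)) e -> exists (Ae : set (dual Y)) (t : R),
     [/\ Ae `<=` A, `|t| = 1 & closure (Ae : set (weak_star Y)) (t *: e)]) ->
  norming_set A.
Proof.
move=> exA y d d0.
pose F : set {ptws Y -> R^o} := @functional_ball R Y `&` [set f | f y = `|y|].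
have [||||e eext [_ ey]] := @extremal_subset_extreme_point R Y F.
- by move=> f [].
- apply: closedI; first exact: functional_ball_closed.
  apply: (@closed_comp _ _ (fun f : {ptws Y -> R^o} => f y) [set r : R | r = `|y|]).
    by move=> f _; exact: ptws_eval_continuous.
  exact: closed_eq.
- by have [f fK fy] := hahn_banach_norming y; exists f.
- move=> a b t aK bK /andP[t0 t1] [_ abE].
  have {}abE : t * a y + (1 - t) * b y = `|y| by [].
  have ay : a y <= `|y| by rewrite (le_trans (ler_norm _))// aK.2.
  have by_ : b y <= `|y| by rewrite (le_trans (ler_norm _))// bK.2.
  by split; split=> //=; nra.
have [Ae [t [AeA t1 cle]]] := exA _ eext.
have [f Aef fy] := weak_star_closure_eval y cle d0.
exists f; first exact: AeA.
have -> : `|y| = `|(t *: e) y|.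
  rewrite -[RHS]/(`|t * e y|) normrM t1 mul1r.
  by have -> : e y = `|y| by []; rewrite normr_id.
rewrite ltrBlDr -ltrBlDl; apply: le_lt_trans fy.
by rewrite distrC (le_trans _ (lerB_dist _ _)).
Qed.

(** Since [|T| = |f0 o T|], points where [f0 o T] attains its norm serve for [T]. Strong
    orthogonality passes to [f0 o T]: a failure at [l] persists, by convexity, at small multiples of
    [l], where the gap keeps every other [f] in [A] below [|T|]. *)
Lemma isolated_adjusted_BS (X Y : normedModType R) (A : set (dual Y)) (f0 : dual Y)
    (T : Bop X Y) c :
  A `<=` unit_ball (dual Y) -> norming_set A -> A f0 -> 0 < c ->
  (forall f, A f -> f <> f0 -> `|Bop_comp f T| + c <= `|Bop_comp f0 T|) ->
  adjusted_BS X R^o (Bop_comp f0 T) -> adjusted_BS X Y T.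
Proof.
move=> A1 nA Af0 c0 gap [[x1 x1M] BSf].
have f01 : `|f0| <= 1 by exact: A1.
have Tf0 : `|T| = `|Bop_comp f0 T|.
  apply/eqP; rewrite eq_le unit_ball_comp_le// andbT.
  apply: norming_set_le nA _ => // f Af.
  have [->//|ff0] := pselect (f = f0).
  by rewrite (le_trans _ (gap f Af ff0))// lerDl ltW.
have f0_le y : `|f0 y| <= `|y|.
  by rewrite (le_trans (Bop_apply_le f0 y))// ler_piMl.
have sub : attaining_set (Bop_comp f0 T) `<=` attaining_set T.
  move=> x [x_1 xM]; split=> //; apply/eqP; rewrite eq_le; apply/andP; split.
    by rewrite (le_trans (Bop_apply_le T x))// x_1 mulr1.
  by rewrite Tf0 -xM f0_le.
split; first by exists x1; exact: sub.
move=> S TS; have [/BSf[x0 x0M x0orth]|] :=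
    pselect (strong_bj_orth (Bop_comp f0 T) (Bop_comp f0 S)).
  exists x0; first exact: sub.
  move=> l; have [_ ->] := sub _ x0M; rewrite Tf0; have [_ <-] := x0M.
  rewrite (le_trans (x0orth l))//.
  have -> : Bop_comp f0 T x0 + l *: Bop_comp f0 S x0 = f0 (T x0 + l *: S x0).
    by rewrite linearD linearZ.
  exact: f0_le.
move=> /existsNP[l /not_implyP[l0 /negP]]; rewrite -leNgt => hl; exfalso.
have D0 : 0 < `|l| * `|S| + 1 by rewrite ltr_wpDl// mulr_ge0.
(* Then [t * |l| * |S| <= c], so the gap absorbs [(t * l) *: S]; at [f0], [t <= 1] permits a convex
   combination. *)
pose t := Num.min 1 (c / (`|l| * `|S| + 1)).
have t0 : 0 < t by rewrite lt_min ltr01 divr_gt0.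
have t1 : t <= 1 by rewrite ge_min lexx.
have tc : t * (`|l| * `|S| + 1) <= c by rewrite -ler_pdivlMr// ge_min lexx orbT.
have : `|T| < `|T + (t * l) *: S|.
  by apply: TS; apply/eqP; apply: mulf_neq0; [exact: lt0r_neq0|exact/eqP].
apply/negP; rewrite -leNgt; apply: norming_set_le nA _ => // f Af.
rewrite Bop_compD Bop_compZ.
have [->|ff0] := pselect (f = f0).
  have -> : Bop_comp f0 T + (t * l) *: Bop_comp f0 S =
      (1 - t) *: Bop_comp f0 T + t *: (Bop_comp f0 T + l *: Bop_comp f0 S).
    by rewrite scalerBl scalerDr scale1r scalerA addrA subrK.
  rewrite (le_trans (ler_normD _ _))// !normrZ (gtr0_norm t0) ger0_norm ?subr_ge0//.
  by rewrite Tf0; nra.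
rewrite (le_trans (ler_normD _ _))// normrZ normrM (gtr0_norm t0) Tf0.
rewrite (le_trans _ (gap f Af ff0))// lerD2l (le_trans _ tc)//.
rewrite -mulrA ler_pM2l// (@le_trans _ _ (`|l| * `|S|)) ?lerDl//.
by rewrite ler_wpM2l// unit_ball_comp_le//; exact: A1.
Qed.

(** The advantage [h * N * (1 - r)] is [8 * d], and the approximations cost [2 * d + h * d + r * d],
    at most half of it. Here [N = |V|] and [p = |psi|]. *)
Lemma isolated_gap_bound (N h r d p : R) : 0 < N -> 0 < h -> h <= 1 -> 0 <= r -> r < 1 ->
  d = h * N * (1 - r) / 8 -> (1 + h) * (N - d) - d <= p ->
  N + r * (h * N + d) + h * N * (1 - r) / 2 <= p.
Proof.
move=> N0 h0 h1 r0 r1 dE; apply: le_trans.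
have hN : 0 < h * N by rewrite mulr_gt0.
have d0 : 0 < d by rewrite dE divr_gt0// mulr_gt0// subr_gt0.
have -> : h * N * (1 - r) / 2 = 4 * d by rewrite dE; field.
have e : h * N * (1 - r) = 8 * d by rewrite dE; field.
have : 0 <= d * (1 - h) by rewrite mulr_ge0 ?subr_ge0// ltW.
have : 0 <= d * (1 - r) by rewrite mulr_ge0 ?subr_ge0// ltW.
by move=> a b; lra.
Qed.

Theorem adjusted_BS_dense (X : normedModType R) (Y : completeNormedModType R) :
  property_quasi_beta Y -> dense (adjusted_BS X R^o) -> dense (adjusted_BS X Y).
Proof.
move=> [A [sigma [rho [A1 sigma1 Asigma Arho Aext]]]] /normed_denseP dX.
apply/normed_denseP => T eps eps0.
have nA : norming_set A.
  by apply: extreme_norming => e /Aext[Ae [t [? ? ? _]]]; exists Ae, t.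
have Aball : A `<=` unit_ball (dual Y).
  by move=> f /A1; rewrite /unit_ball/= => ->.
have [T0|T0] := eqVneq T 0.
  exists T; last by rewrite subrr normr0 ltW.
  (* The zero operator attains its norm at any unit vector; density of the functionals provides
     one. *)
  have [psi [[x [x1 _]] _] _] := dX 0 1 ltr01.
  have xT : attaining_set T x by split; rewrite // T0 !normr0.
  split; first by exists x.
  by move=> S _; exists x => // l; rewrite T0 normr0.
have {}T0 : 0 < `|T| by rewrite normr_gt0.
(* The first bound leaves [eps / 2] for the second perturbation; the other one makes [V] nonzero. *)
pose e1 := Num.min (eps / 2) (`|T| / 2).
have e10 : 0 < e1 by rewrite lt_min !divr_gt0.
have [V [e [VT eext eV]]] := extreme_adjoint_attaining_dense T e10.
have V0 : 0 < `|V|.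
  have : e1 <= `|T| / 2 by rewrite ge_min lexx orbT.
  have := lerB_dist T V; rewrite distrC => h1 h2; lra.
set N := `|V| in V0 eV.
have [Ae [t [AeA t1 cle supAe]]] := Aext e eext.
have [r [r0 r1 rhor]] := ereal_sup_lt1 supAe.
(* So [h * N <= eps / 4], and with [d] below [h * N / 8] the second perturbation stays within
   [eps / 2]. *)
pose h := Num.min 1 (eps / (4 * N)).
have h0 : 0 < h by rewrite lt_min ltr01 divr_gt0// mulr_gt0.
have h1 : h <= 1 by rewrite ge_min lexx.
have heps : h * (4 * N) <= eps by rewrite -ler_pdivlMr ?mulr_gt0// ge_min lexx orbT.
have hN0 : 0 < h * N by rewrite mulr_gt0.
pose d := h * N * (1 - r) / 8.
have d0 : 0 < d by rewrite divr_gt0// mulr_gt0// subr_gt0.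
(* At a vector nearly norming [e o V], the value of [t *: e] is approximated by an element of [Ae],
   where [rho] is at most [r]. *)
have [f0 Aef0 f0V] : exists2 f0, Ae f0 & N - d <= `|Bop_comp f0 V|.
  have d20 : 0 < d / 2 by rewrite divr_gt0.
  have [w w1 Vw] := Bop_norm_adherent (Bop_comp e V) d20.
  have [f Aef fe] := weak_star_closure_eval (V w) cle d20.
  exists f => //.
  have fVw : `|f (V w)| <= `|Bop_comp f V|.
    by rewrite (le_trans (Bop_apply_le (Bop_comp f V) w))// ler_piMr.
  have ew : `|(t *: e) (V w)| = `|Bop_comp e V w|.
    by rewrite -[LHS]/(`|t * e (V w)|) normrM t1 mul1r.
  have := lerB_dist ((t *: e) (V w)) (f (V w)).
  by rewrite distrC ew; rewrite eV in Vw; lra.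
have Af0 := AeA _ Aef0.
set phi := Bop_comp f0 V in f0V.
have phiN : `|phi| <= N by apply: unit_ball_comp_le; exact: Aball.
have [psi psiBS psid] := dX ((1 + h) *: phi) d d0.
have psi_phi : `|psi - phi| <= h * N + d.
  have -> : psi - phi = h *: phi + (psi - (1 + h) *: phi).
    by rewrite scalerDl scale1r [RHS]addrC opprD addrA subrK.
  by rewrite (le_trans (ler_normD _ _))// lerD// normrZ gtr0_norm// ler_pM2l.
(* As [f0 (sigma f0) = 1], composing with [f0] gives exactly [psi]; for any other [f] in [A] the
   correction is scaled by at most [r]. *)
pose W := V + rank_one (psi - phi) (sigma f0).
have fW f : Bop_comp f W = Bop_comp f V + (f (sigma f0) : R) *: (psi - phi).
  apply/val_inj/funext => x.
  rewrite -[LHS]/(f (V x + (psi - phi) x *: sigma f0)) linearD linearZ.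
  by rewrite -[RHS]/(f (V x) + f (sigma f0) * (psi - phi) x) mulrC.
have f0W : Bop_comp f0 W = psi by rewrite fW Asigma// scale1r addrC subrK.
have dle : 8 * d <= h * N.
  have -> : 8 * d = h * N * (1 - r) by rewrite /d; field.
  by rewrite ler_piMr ?(ltW hN0)// gerBl.
exists W; last first.
  rewrite -(subrKA V) (le_trans (ler_normD _ _))//.
  have : `|W - V| <= h * N + d.
    rewrite /W addrAC subrr add0r (le_trans (rank_one_norm _ _))//.
    by rewrite sigma1// mulr1.
  have : e1 <= eps / 2 by rewrite ge_min lexx.
  lra.
have c0 : 0 < h * N * (1 - r) / 2 by rewrite divr_gt0// mulr_gt0// subr_gt0.
apply: (@isolated_adjusted_BS _ _ A f0 W _ Aball nA Af0 c0); last by rewrite f0W.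
move=> f Af ff0.
have psi_ge : (1 + h) * (N - d) - d <= `|psi|.
  have := lerB_dist ((1 + h) *: phi) psi.
  rewrite distrC normrZ gtr0_norm ?addr_gt0// => h2.
  have h3 : (1 + h) * (N - d) <= (1 + h) * `|phi| by rewrite ler_pM2l// addr_gt0.
  lra.
rewrite f0W; apply: le_trans (isolated_gap_bound V0 h0 h1 r0 r1 erefl psi_ge).
rewrite lerD2r fW (le_trans (ler_normD _ _))// lerD//.
  by apply: unit_ball_comp_le; exact: Aball.
rewrite normrZ ler_pM//.
have /andP[+ _] := Arho f0 f Af0 Af (nesym ff0).
by move=> /le_trans; apply; exact: rhor.
Qed.

End quasi_beta.

(** * Functionals on L^1 *)

Section L1.
Context d (T : measurableType d) (R : realType).
Variable mu : {finite_measure set T -> \bar R}.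

Local Notation X := (LspaceType1 mu).
Local Notation integrable f := (mu.-integrable setT (EFin \o f)).
Local Notation I f := (Rintegral mu setT f).

(** Total, with default value 0 outside [Lfun mu 1], so that explicit formulas need no packed proof
    of integrability. *)
Definition L1_class (f : T -> R) : X :=
  if pselect (f \in Lfun mu 1) is left fP then Lspace_class (Lfun_Sub (lexx 1%E) fP)
  else 0.

Lemma L1_classE (f : LfunType mu (lexx 1%E)) : L1_class f = Lspace_class f.
Proof.
rewrite /L1_class; case: pselect => [fP|]; last by case; exact: LfunP.
by congr Lspace_class; exact/LfuneqP.
Qed.

Lemma integrable_LfunE (f : T -> R) : integrable f ->
  exists g : LfunType mu (lexx 1%E), f = g.
Proof. by move=> /Lfun1_integrable fi; exists (Lfun_Sub (lexx 1%E) fi). Qed.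

Lemma L1_classP (x : X) : exists2 f, integrable f & x = L1_class f.
Proof.
exists (Lspace_repr x); first exact/Lfun1_integrable/LfunP.
by rewrite L1_classE Lspace_reprK.
Qed.

Lemma L1_classD f g : integrable f -> integrable g ->
  L1_class (fun x => f x + g x) = L1_class f + L1_class g.
Proof.
move=> /integrable_LfunE[f' ->] /integrable_LfunE[g' ->].
by rewrite -[fun x => _]/(f' + g' : T -> R) !L1_classE Lspace_classD.
Qed.

Lemma L1_classZ a f : integrable f ->
  L1_class (fun x => a * f x) = a *: L1_class f.
Proof.
move=> /integrable_LfunE[f' ->].
by rewrite -[fun x => _]/(a *: f' : T -> R) !L1_classE Lspace_classZ.
Qed.

Lemma integrable_measurable (f : T -> R) : integrable f -> measurable_fun setT f.
Proof. by move=> /measurable_int/measurable_EFinP. Qed.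

Lemma L1_class_norm f : integrable f -> `|L1_class f| = I (fun x => `|f x|).
Proof.
move=> /integrable_LfunE[f' ->]; rewrite L1_classE.
rewrite -[LHS]/(Lspace_norm _) Lspace_norm_class Lnorm1.
by [].
Qed.

Lemma L1_class_inj f g : integrable f -> integrable g ->
  L1_class f = L1_class g -> f = g %[ae mu].
Proof.
move=> /integrable_LfunE[f' ->] /integrable_LfunE[g' ->].
by rewrite !L1_classE => /Lspace_classP.
Qed.

Lemma integrable_bounded_mul (g f : T -> R) M : measurable_fun setT g ->
  (forall x, `|g x| <= M) -> integrable f -> integrable (fun x => g x * f x).
Proof.
move=> mg gM fi.
apply: (@le_integrable _ _ _ mu setT measurableT _ (fun x => (M * f x)%:E)).
- by apply/measurable_EFinP; apply: measurable_funM => //; exact: integrable_measurable.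
- move=> x _; rewrite /= lee_fin !normrM ler_wpM2r// (le_trans (gM x))//.
  exact: ler_norm.
- by have := integrableZl measurableT M fi.
Qed.

Lemma ae_eq_RintegralM (g f h : T -> R) M : measurable_fun setT g ->
  (forall x, `|g x| <= M) -> integrable f -> integrable h -> f = h %[ae mu] ->
  I (fun x => g x * f x) = I (fun x => g x * h x).
Proof.
move=> mg gM fi hi fh; congr fine; apply: ae_eq_integral => //.
- by apply/measurable_EFinP; apply: measurable_funM => //; exact: integrable_measurable.
- by apply/measurable_EFinP; apply: measurable_funM => //; exact: integrable_measurable.
- by apply: filterS fh => x /= /[apply] ->.
Qed.

Lemma integrableD_EFin (f g : T -> R) : integrable f -> integrable g ->
  integrable (fun x => f x + g x).
Proof. by move=> fi gi; have := integrableD measurableT fi gi. Qed.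

Lemma integrableZ_EFin a (f : T -> R) : integrable f -> integrable (fun x => a * f x).
Proof. by move=> fi; have := integrableZl measurableT a fi. Qed.

Lemma integrable_norm_EFin (f : T -> R) : integrable f -> integrable (fun x => `|f x|).
Proof. by move=> fi; have := integrable_abse fi. Qed.

Lemma le_normr_RintegralM (g f : T -> R) M : measurable_fun setT g ->
  (forall x, `|g x| <= M) -> integrable f ->
  `|I (fun x => g x * f x)| <= M * I (fun x => `|f x|).
Proof.
move=> mg gM fi; have gfi := integrable_bounded_mul mg gM fi.
rewrite (le_trans (le_normr_Rintegral measurableT gfi))//.
rewrite -RintegralZl//; last exact: integrable_norm_EFin.
apply: le_Rintegral => //; first exact: integrable_norm_EFin.
  exact/integrableZ_EFin/integrable_norm_EFin.
by move=> x _; rewrite normrM ler_wpM2r.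
Qed.

Lemma L1_density (g : T -> R) M : 0 <= M -> measurable_fun setT g -> (forall x, `|g x| <= M) ->
  exists2 phi : Bop X R^o, `|phi| <= M &
    forall f, integrable f -> phi (L1_class f) = I (fun x => g x * f x).
Proof.
move=> M0 mg gM.
pose F (x : X) : R^o := I (fun t => g t * (Lspace_repr x) t).
have FE f : integrable f -> F (L1_class f) = I (fun x => g x * f x).
  move=> fi; have ri : integrable (Lspace_repr (L1_class f)).
    exact/Lfun1_integrable/LfunP.
  apply: (ae_eq_RintegralM mg gM) => //.
  by apply: L1_class_inj => //; rewrite L1_classE Lspace_reprK.
have Fle x : `|F x| <= M * `|x|.
  have [f fi ->] := L1_classP x; rewrite FE// L1_class_norm//.
  exact: le_normr_RintegralM.
have Fb : F \in @bounded_operator R X R^o.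
  rewrite inE; split; last by exists M.
  move=> a x y; have [f fi ->] := L1_classP x; have [h hi ->] := L1_classP y.
  rewrite -L1_classZ// -L1_classD//; last exact: integrableZ_EFin.
  rewrite !FE//; last by apply: integrableD_EFin => //; exact: integrableZ_EFin.
  have gfi := integrable_bounded_mul mg gM fi.
  have ghi := integrable_bounded_mul mg gM hi.
  rewrite -[RHS]/(a * I (fun x => g x * f x) + I (fun x => g x * h x)).
  rewrite -RintegralZl// -RintegralD//; last exact: integrableZ_EFin.
  by apply: eq_Rintegral => t _; rewrite mulrDr mulrCA.
exists (MkBop Fb); last exact: FE.
exact: Bop_norm_leP.
Qed.

Lemma integrable_indic_EFin (A : set T) : measurable A -> integrable (\1_A : T -> R).
Proof. exact: integrable_indic. Qed.

Lemma L1_class_indic_norm (A : set T) : measurable A ->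
  `|L1_class (\1_A)| = fine (mu A).
Proof.
move=> mA; rewrite L1_class_norm; last exact: integrable_indic_EFin.
rewrite /Rintegral; under eq_integral do rewrite ger0_norm//.
by rewrite integral_indic// setIT.
Qed.

Lemma L1_class_sum (s : seq R) (A : R -> set T) : (forall y, measurable (A y)) ->
  integrable (fun x => \sum_(y <- s) y * \1_(A y) x) /\
  L1_class (fun x => \sum_(y <- s) y * \1_(A y) x) =
    \sum_(y <- s) y *: L1_class (\1_(A y)).
Proof.
move=> mA; elim: s => [|y s [IHi IH]].
  under eq_fun do rewrite big_nil; rewrite big_nil.
  have i0 : integrable (fun _ : T => 0 : R) by exact: integrable0.
  by split=> //; have := L1_classZ 0 i0; rewrite scale0r; under eq_fun do rewrite mul0r.
under eq_fun do rewrite big_cons; rewrite big_cons.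
have yi : integrable (fun x => y * \1_(A y) x).
  exact/integrableZ_EFin/integrable_indic_EFin.
split; first exact: integrableD_EFin.
by rewrite L1_classD// L1_classZ ?IH//; exact: integrable_indic_EFin.
Qed.

Import HBSimple.

(** Indicators determine the values on simple functions, which are dense in L^1. *)
Lemma L1_functional_eq (phi psi : Bop X R^o) :
  (forall A, measurable A -> phi (L1_class \1_A) = psi (L1_class \1_A)) -> phi = psi.
Proof.
move=> eq1; apply/val_inj/funext => x; have [f fi ->] := L1_classP x.
have [g [gi _ gf]] := approximation_sfun_integrable measurableT fi.
have eqg n : phi (L1_class (g n)) = psi (L1_class (g n)).
  have mA y : measurable (g n @^-1` [set y]) by [].
  have [s gE] : exists s : seq R,
      (g n : T -> R) = fun t => \sum_(y <- s) y * \1_(g n @^-1` [set y]) t.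
    by eexists; apply/funext => t; rewrite fimfunE fsbig_finite.
  rewrite gE.
  rewrite (L1_class_sum s mA).2 !linear_sum; apply: eq_bigr => y _.
  by rewrite !linearZ /= eq1.
apply/eqP; rewrite -subr_eq0 -normr_le0; apply/ler_addgt0Pl => e e0; rewrite addr0.
have D0 : 0 < `|phi| + `|psi| + 1 by rewrite ltr_wpDl// addr_ge0.
have /fine_cvgP[_ /cvgrPdist_lt/(_ (e / (`|phi| + `|psi| + 1)))] := gf.
rewrite divr_gt0// => /(_ isT)[n _ /(_ n (leqnn n))/=].
rewrite sub0r normrN => fgn.
have fgi : integrable (fun x => f x + -1 * g n x).
  by apply: integrableD_EFin => //; exact: integrableZ_EFin.
have : `|L1_class (fun x => f x + -1 * g n x)| < e / (`|phi| + `|psi| + 1).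
  rewrite L1_class_norm// (le_lt_trans _ fgn)// (le_trans (ler_norm _))//.
  by under eq_Rintegral do rewrite mulN1r.
rewrite L1_classD//; last exact: integrableZ_EFin.
rewrite L1_classZ// scaleN1r ltr_pdivlMr// => /ltW; apply: le_trans.
set u := L1_class f; set v := L1_class (g n).
have -> : phi u - psi u = (phi - psi) (u - v).
  by rewrite linearB /= -[X in _ = _ - X]/(phi v - psi v) eqg subrr subr0.
rewrite (le_trans (Bop_apply_le _ _))// mulrC ler_wpM2l//.
by rewrite (le_trans (ler_normB _ _))// lerDl.
Qed.

End L1.

(** * The dual of L^1 through the Radon-Nikodym theorem *)

Section L1_dual.
Context d (T : measurableType d) (R : realType).
Variable mu : {finite_measure set T -> \bar R}.

Local Notation X := (LspaceType1 mu).
Local Notation integrable f := (mu.-integrable setT (EFin \o f)).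
Local Notation I f := (Rintegral mu setT f).

Section functional_charge.
Variable phi : Bop X R^o.

(** Its Radon-Nikodym derivative with respect to [mu] is the density of [phi]. *)
Definition functional_charge (A : set T) : \bar R :=
  (phi (L1_class mu \1_A) : R)%:E.

Local Notation nu := functional_charge.

Lemma functional_charge_le A : measurable A ->
  `|phi (L1_class mu \1_A)| <= `|phi| * fine (mu A).
Proof.
by move=> mA; rewrite (le_trans (Bop_apply_le _ _))// L1_class_indic_norm.
Qed.

Lemma functional_chargeU A B : measurable A -> measurable B -> A `&` B = set0 ->
  nu (A `|` B) = (nu A + nu B)%E.
Proof.
move=> mA mB AB; rewrite /nu -EFinD; congr EFin.
have -> : \1_(A `|` B) = (fun x => \1_A x + \1_B x : R).
  apply/funext => x; rewrite !indicE in_setU.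
  have [xA|xA] := boolP (x \in A); have [xB|xB] := boolP (x \in B);
    rewrite ?addr0 ?add0r//.
  have : (A `&` B) x by split; exact: set_mem.
  by rewrite AB.
by rewrite L1_classD ?linearD//; exact: integrable_indic_EFin.
Qed.

Lemma functional_charge0 : nu set0 = 0%E.
Proof.
congr EFin; apply/eqP; rewrite -normr_le0 (le_trans (functional_charge_le _))//.
by rewrite measure0 mulr0.
Qed.

(** The value on a tail is at most [|phi|] times its measure, which tends to 0 because [mu] is
    finite. *)
Lemma functional_charge_sigma_additive : semi_sigma_additive nu.
Proof.
move=> F mF tF mU.
have mUn n : measurable (\big[setU/set0]_(i < n) F i).
  by apply: bigsetU_measurable => i _.
have sumE n : (\sum_(0 <= i < n) nu (F i) = nu (\big[setU/set0]_(i < n) F i))%E.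
  elim: n => [|n IH]; first by rewrite big_nil big_ord0 functional_charge0.
  rewrite big_nat_recr//= IH big_ord_recr/= functional_chargeU//; first exact: mUn.
  apply/seteqP; split=> // x [+ Fnx]; rewrite -bigcup_mkord => -[i /= ni Fix].
  by move: ni; rewrite (tF i n Logic.I Logic.I (ex_intro _ x (conj Fix Fnx))) ltnn.
under eq_fun do rewrite sumE.
pose U := \bigcup_i F i; pose Un n := \big[setU/set0]_(i < n) F i.
have mD n : measurable (U `\` Un n) by exact: measurableD mU (mUn n).
have UE n : U = Un n `|` (U `\` Un n).
  by rewrite setDUK//; exact: bigsetU_bigcup.
have UnD n : Un n `&` (U `\` Un n) = set0 by rewrite setDE setICA setICr setI0.
have muUn n : fine (mu (Un n)) + fine (mu (U `\` Un n)) = fine (mu U).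
  have muD : mu U = (mu (Un n) + mu (U `\` Un n))%E.
    by rewrite {1}(UE n); exact: measureU (mUn n) (mD n) (UnD n).
  by rewrite muD fineD// fin_num_measure//; exact: mUn.
have mu_cvg : (fun n => fine (mu (Un n))) @ \oo --> fine (mu U).
  have : (fun n => mu (Un n)) @ \oo --> mu U.
    rewrite (_ : (fun n => mu (Un n)) = (fun n => \sum_(0 <= i < n) mu (F i))%E).
      exact: measure_semi_sigma_additive.
    by apply/funext => n; rewrite big_mkord -measure_bigsetU.
  rewrite -[mu U]fineK ?fin_num_measure//.
  by move=> /fine_cvgP[].
apply: cvg_EFin; first by apply: nearW.
apply/cvgrPdist_le => e e0.
have phi0 : 0 < `|phi| + 1 by rewrite ltr_wpDl.
have /cvgrPdist_le/(_ (e / (`|phi| + 1))) := mu_cvg.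
rewrite divr_gt0// => /(_ isT); apply: filterS => n.
rewrite -(muUn n) addrAC subrr add0r => mDe.
have -> : fine (nu (\bigcup_n F n)) - fine (nu (Un n)) = phi (L1_class mu \1_(U `\` Un n)).
  have := functional_chargeU (mUn n) (mD n) (UnD n); rewrite -UE /nu -EFinD => -[].
  by rewrite /= => ->; rewrite addrAC subrr add0r.
rewrite (le_trans (functional_charge_le _))//.
move: mDe; rewrite ler_pdivlMr// mulrC => /(le_trans _); apply.
rewrite (@le_trans _ _ (`|phi| * `|fine (mu (U `\` Un n))|))//.
  by rewrite ler_wpM2l// ler_norm.
by rewrite ler_wpM2r// lerDl.
Qed.

HB.instance Definition _ := isCharge.Build _ T R functional_charge
  functional_charge0 (fun _ _ => isT) functional_charge_sigma_additive.

Lemma functional_charge_dominated : nu `<< mu.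
Proof.
move=> N N0 A mA AN; congr EFin; apply/eqP.
by rewrite -normr_le0 (le_trans (functional_charge_le mA))// N0// mulr0.
Qed.

End functional_charge.
(** The function [h - c] is positive on the superlevel set and has integral at most 0 there. *)
Lemma superlevel_null (h : T -> R) c : integrable h ->
  \int[mu]_(x in [set x | c < h x]) h x <= c * fine (mu [set x | c < h x]) ->
  mu [set x | c < h x] = 0%E.
Proof.
move=> hi; set B := [set x | c < h x] => hB.
have mh := integrable_measurable hi.
have mB : measurable B.
  have -> : B = setT `&` h @^-1` `]c, +oo[.
    by rewrite setTI; apply/seteqP; split=> x; rewrite /B /= in_itv/= andbT.
  exact: mh.
have hiB : mu.-integrable B (EFin \o h) by apply: integrableS hi.
have ciB : mu.-integrable B (EFin \o cst c).
  exact: finite_measure_integrable_cst.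
have hcB : mu.-integrable B (fun x => (h x - c)%:E).
  by have := integrableB mB hiB ciB.
have : ae_eq mu B (fun x => (h x - c)%:E) (cst 0%E).
  apply/ae_eq_integral_abs => //; first exact: measurable_int hcB.
  have -> : (\int[mu]_(x in B) `|(h x - c)%:E| = \int[mu]_(x in B) (h x - c)%:E)%E.
    apply: eq_integral => x /set_mem xB.
    by rewrite gee0_abs// lee_fin subr_ge0 ltW.
  apply/eqP; rewrite eq_le; apply/andP; split; last first.
    by apply: integral_ge0 => x xB; rewrite lee_fin subr_ge0 ltW.
  rewrite -[leLHS]fineK; last exact: integrable_fin_num hcB.
  rewrite lee_fin -/(Rintegral mu B (fun x => h x - c)) RintegralB//.
  by rewrite Rintegral_cst// subr_le0.
move=> Bae; apply/negligibleP => //; apply: negligibleS Bae => x Bx /= /(_ Bx)/eqP.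
by rewrite eqe subr_eq0 gt_eqF.
Qed.

(** Over the set where the Radon-Nikodym density, or its opposite, exceeds [|phi|], its integral is
    at most [|phi|] times the measure, so that set is null. *)
Lemma L1_representation (phi : Bop X R^o) :
  exists g : T -> R, [/\ measurable_fun setT g, (forall x, `|g x| <= `|phi|) &
    forall f, integrable f -> phi (L1_class mu f) = I (fun x => g x * f x)].
Proof.
pose nu : {charge set T -> \bar R} := functional_charge phi.
have numu : nu `<< mu := @functional_charge_dominated phi.
pose g0 := Radon_Nikodym nu mu.
have g0i : mu.-integrable setT g0 := Radon_Nikodym_integrable numu.
have g0fin x : g0 x \is a fin_num := Radon_Nikodym_fin_num x numu.
pose h x := fine (g0 x).
have hE : EFin \o h = g0 by apply/funext => x; rewrite /= fineK.
have hi : integrable h by rewrite hE.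
have mh := integrable_measurable hi.
have hA A : measurable A -> \int[mu]_(x in A) h x = phi (L1_class mu \1_A).
  move=> mA; rewrite /Rintegral -[fun x => _]/(EFin \o h) hE.
  by rewrite -Radon_Nikodym_integral.
pose M := `|phi|.
have null s : `|s| = 1 -> {ae mu, forall x, s * h x <= M}.
  move=> s1; pose B := [set x | M < s * h x].
  have mB : measurable B.
    have -> : B = setT `&` (fun x => s * h x) @^-1` `]M, +oo[.
      by rewrite setTI; apply/seteqP; split=> x; rewrite /B /= in_itv/= andbT.
    by apply: measurable_funM.
  apply: (@negligibleS _ _ _ mu B) => [x /negP|]; first by rewrite -ltNge.
  apply/negligibleP => //; apply: superlevel_null; first exact: integrableZ_EFin.
  rewrite -/B RintegralZl//; last exact: integrableS hi.
  rewrite hA// (le_trans (ler_norm _))// normrM s1 mul1r.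
  exact: functional_charge_le.
(* Truncation makes the almost everywhere bound hold everywhere. *)
pose g x := Num.max (- M) (Num.min M (h x)).
have M0 : 0 <= M by exact: normr_ge0.
have mg : measurable_fun setT g.
  by apply: measurable_maxr => //; exact: measurable_minr.
have gM x : `|g x| <= M.
  by rewrite ler_norml /g le_max lexx/= ge_max ge_min lexx/= ge0_cp.
have gh : g = h %[ae mu].
  have N1 := null 1 (normr1 _); have N2 := null (-1) (normrN1 _).
  apply: filterS2 N1 N2 => x; rewrite mul1r mulN1r => h1 h2 _.
  by rewrite /g (min_idPr h1) (max_idPr _)// lerNl.
have [psi _ psiE] := L1_density mu M0 mg gM.
exists g; split=> // f fi; suff -> : phi = psi by exact: psiE.
apply: L1_functional_eq => A mA.
rewrite psiE; last exact: integrable_indic_EFin.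
rewrite -hA// Rintegral_mkcond patch_indic/=.
congr fine; apply: ae_eq_integral => //.
- exact/measurable_EFinP/measurable_funM.
- exact/measurable_EFinP/measurable_funM.
- by apply: filterS gh => x /= /[apply] ->.
Qed.

End L1_dual.

(** * Density of the adjusted Bhatia-Semrl functionals on L^1 *)

Section L1_functionals.
Context d (T : measurableType d) (R : realType).
Variable mu : {finite_measure set T -> \bar R}.

Local Notation X := (LspaceType1 mu).
Local Notation integrable f := (mu.-integrable setT (EFin \o f)).
Local Notation I f := (Rintegral mu setT f).

(** The everywhere bound [C] makes [g * f] integrable; the almost everywhere bound [M] controls the
    norm. *)
Lemma L1_functional_norm_le (phi : Bop X R^o) (g : T -> R) C M :
  0 <= M -> measurable_fun setT g -> (forall x, `|g x| <= C) ->
  {ae mu, forall x, `|g x| <= M} ->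
  (forall f, integrable f -> phi (L1_class mu f) = I (fun x => g x * f x)) ->
  `|phi| <= M.
Proof.
move=> M0 mg gC gM phiE; apply: Bop_norm_leP => // x.
have [f fi ->] := L1_classP x; rewrite phiE// L1_class_norm//.
have gfi := integrable_bounded_mul mg gC fi.
rewrite (le_trans (le_normr_Rintegral measurableT gfi))//.
have nfi := integrable_norm_EFin fi.
rewrite -RintegralZl//.
apply: fine_le.
- exact: (integrable_fin_num measurableT (integrable_norm_EFin gfi)).
- exact: (integrable_fin_num measurableT (integrableZ_EFin M nfi)).
apply: ae_ge0_le_integral => //.
- exact: measurable_int (integrable_norm_EFin gfi).
- by move=> t _; rewrite lee_fin mulr_ge0.
- exact: measurable_int (integrableZ_EFin M nfi).
- by apply: filterS gM => t gt _; rewrite lee_fin normrM ler_wpM2r.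
Qed.

Lemma superlevel_measurable (g : T -> R) a : measurable_fun setT g ->
  measurable [set x | a <= g x].
Proof.
move=> mg; have -> : [set x | a <= g x] = setT `&` g @^-1` `[a, +oo[.
  by rewrite setTI; apply/seteqP; split=> x; rewrite /= in_itv/= andbT.
exact: mg.
Qed.

(** * Functionals with density of modulus [M] on [E] and at most [M - e] elsewhere *)

Section flattened.
Variables (g' s : T -> R) (E : set T) (M e : R) (psi : Bop X R^o).
Hypotheses (M0 : 0 < M) (e0 : 0 < e) (mg' : measurable_fun setT g')
  (ms : measurable_fun setT s) (mE : measurable E) (muE : mu E != 0%E).
Hypotheses (s1 : forall x, s x * s x = 1) (g'E : forall x, E x -> g' x = s x * M)
  (g'nE : forall x, ~ E x -> `|g' x| <= M - e).
Hypothesis psiE : forall f, integrable f ->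
  psi (L1_class mu f) = I (fun x => g' x * f x).

Let s_norm x : `|s x| = 1.
Proof. by apply/eqP; rewrite -sqrp_eq1// -normrX expr2 s1 normr1. Qed.

Let g'M x : `|g' x| <= M.
Proof.
have [xE|xE] := pselect (E x); first by rewrite g'E// normrM s_norm mul1r gtr0_norm.
by rewrite (le_trans (g'nE xE))// gerBl ltW.
Qed.

(** The normalized indicator of [P], signed like [g']; for [P] in [E] of positive measure, [psi]
    takes the value [M] at it. *)
Let u (P : set T) : X := L1_class mu (fun x => s x * ((fine (mu P))^-1 * \1_P x)).

Lemma flattened_norm_le : `|psi| <= M.
Proof.
apply: L1_functional_norm_le psiE => //; first exact: ltW.
exact: nearW.
Qed.

Lemma flattened_test (P : set T) (h : Bop X R^o) (k : T -> R) :
  P `<=` E -> measurable P -> mu P != 0%E ->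
  measurable_fun setT k -> (forall x, `|k x| <= `|h|) ->
  (forall f, integrable f -> h (L1_class mu f) = I (fun x => k x * f x)) ->
  (forall x, P x -> 0 <= s x * k x) ->
  [/\ `|u P| <= 1, psi (u P) = M & 0 <= h (u P)].
Proof.
move=> PE mP muP mk kh hE skP.
have muP0 : 0 < fine (mu P).
  by rewrite fine_gt0// lt0e muP measure_ge0/= ltey_eq fin_num_measure.
have i1 : integrable (fun x => (fine (mu P))^-1 * \1_P x).
  exact/integrableZ_EFin/integrable_indic_EFin.
have si : integrable (fun x => s x * ((fine (mu P))^-1 * \1_P x)).
  by apply: (integrable_bounded_mul ms _ i1) => x; rewrite s_norm.
have I1 : I (fun x => (fine (mu P))^-1 * \1_P x) = 1.
  rewrite RintegralZl//; last exact: integrable_indic_EFin.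
  by rewrite /Rintegral integral_indic// setIT mulVf// gt_eqF.
split.
- rewrite /u L1_class_norm// -I1 le_eqVlt; apply/orP; left; apply/eqP.
  apply: eq_Rintegral => x _; rewrite normrM s_norm mul1r ger0_norm//.
  by rewrite mulr_ge0// invr_ge0 ltW.
- rewrite /u psiE//.
  rewrite (_ : (fun x => _) = (fun x => M * ((fine (mu P))^-1 * \1_P x))).
    by rewrite RintegralZl// I1 mulr1.
  apply/funext => x; rewrite indicE; have [xP|xP] := boolP (x \in P).
    rewrite g'E; last exact/PE/set_mem.
    by rewrite mulrACA s1 mul1r.
  by rewrite !mulr0.
- rewrite /u hE//; apply: Rintegral_ge0 => x _; rewrite indicE.
  have [xP|xP] := boolP (x \in P); last by rewrite !mulr0.
  rewrite mulr1 mulrA [k x * s x]mulrC mulr_ge0 ?invr_ge0 ?(ltW muP0)//.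
  exact/skP/set_mem.
Qed.

Lemma flattened_point : exists x, `|x| <= 1 /\ psi x = M.
Proof.
(* The test is run with the zero functional, whose density is 0. *)
have [||||u1 psiu _] := @flattened_test E 0 (cst 0) (@subset_refl _ E) mE muE.
- exact: measurable_cst.
- by move=> x; rewrite normr0.
- move=> f fi; rewrite /Rintegral; under eq_integral do rewrite mul0r.
  by rewrite integral0.
- by move=> x _; rewrite mulr0.
- by exists (u E).
Qed.

Lemma flattened_norm : `|psi| = M.
Proof.
have [x [x1 psix]] := flattened_point.
apply/eqP; rewrite eq_le flattened_norm_le/= -[leLHS](gtr0_norm M0) -psix.
by rewrite (le_trans (Bop_apply_le _ _))// ler_piMr.
Qed.

Lemma flattened_attains x : `|x| <= 1 -> psi x = M -> attaining_set psi x.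
Proof.
move=> x1 psix; split; last by rewrite psix flattened_norm gtr0_norm.
apply/eqP; rewrite /unit_sphere/= eq_le x1/=.
have := Bop_apply_le psi x; rewrite psix flattened_norm gtr0_norm//.
by rewrite -[X in X <= _]mulr1 ler_pM2l.
Qed.

(** If [s * k >= 0] on a part of [E] of positive measure, its test vector works. Otherwise a small
    positive multiple of [h] would pull the density of [psi] towards 0 on almost all of [E], against
    strong orthogonality. *)
Lemma flattened_orth_test (h : Bop X R^o) : strong_bj_orth psi h ->
  exists x, [/\ `|x| <= 1, psi x = M & 0 <= h x].
Proof.
move=> psih; have [k [mk kh hE]] := L1_representation h.
pose P := E `&` [set x | 0 <= s x * k x].
have mP : measurable P.
  by apply: measurableI => //; apply: superlevel_measurable; exact: measurable_funM.
have [muP|muP] := eqVneq (mu P) 0%E; last first.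
  exists (u P); apply: (@flattened_test P h k) => //; first exact: subIsetl.
  by move=> x [].
(* otherwise [psi + l *: h] has norm at most [M] for small [l > 0] *)
exfalso; pose l := Num.min e M / (`|h| + 1).
have h1 : 0 < `|h| + 1 by rewrite ltr_wpDl.
have l0 : 0 < l by rewrite divr_gt0// lt_min e0.
(* The bound by [e] keeps the modulus at most [M] off [E]; the bound by [M] prevents overshooting on
   [E]. *)
have lh : l * `|h| <= Num.min e M.
  by rewrite /l mulrAC ler_pdivrMr// ler_wpM2l ?lerDl// le_min !ltW.
have lhe : l * `|h| <= e by rewrite (le_trans lh)// ge_min lexx.
have lhM : l * `|h| <= M by rewrite (le_trans lh)// ge_min lexx orbT.
have klh x : `|l * k x| <= l * `|h|.
  by rewrite normrM gtr0_norm// ler_pM2l.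
have : `|psi + l *: h| <= M.
  apply: (@L1_functional_norm_le _ (fun x => g' x + l * k x) (M + l * `|h|)).
  - exact: ltW.
  - by apply: measurable_funD => //; exact: measurable_funM.
  - by move=> x; rewrite (le_trans (ler_normD _ _))// lerD.
  - apply: (@negligibleS _ _ _ mu P); last exact/negligibleP.
    move=> x /negP; rewrite -ltNge => Mx; apply: contrapT => nPx.
    move: Mx; apply/negP; rewrite -leNgt.
    have [xE|xE] := pselect (E x); last first.
      by rewrite (le_trans (ler_normD _ _))// -[leRHS](subrK e) lerD ?g'nE// (le_trans (klh x)).
    have sk : s x * k x < 0 by rewrite ltNge; apply/negP => sk; apply: nPx.
    have -> : g' x + l * k x = s x * (M + l * (s x * k x)).
      by rewrite g'E// mulrDr mulrCA [s x * (s x * _)]mulrA s1 mul1r.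
    rewrite normrM s_norm mul1r ler_norml.
    have : `|l * (s x * k x)| <= l * `|h|.
      by rewrite normrM gtr0_norm// ler_pM2l// normrM s_norm mul1r.
    rewrite ler_norml => /andP[h2 _].
    have : l * (s x * k x) <= 0 by rewrite pmulr_rle0// ltW.
    by move=> h3; apply/andP; split; lra.
  - move=> f fi.
    rewrite -[LHS]/(psi (L1_class mu f) + l * h (L1_class mu f)) psiE// hE//.
    have gi := integrable_bounded_mul mg' g'M fi.
    have ki := integrable_bounded_mul mk kh fi.
    rewrite -RintegralZl// -RintegralD//; last exact: integrableZ_EFin.
    by apply: eq_Rintegral => x _; rewrite mulrDl mulrA.
move=> hM; have /eqP l_neq0 : l != 0 by rewrite gt_eqF.
by have := psih l l_neq0; rewrite flattened_norm ltNge hM.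
Qed.

(** Testing [h] and [- h] gives two points where [psi] equals [M] and [h] has opposite signs. On the
    segment between them [h] vanishes somewhere while [psi] stays equal to [M]. *)
Lemma flattened_adjusted_BS : adjusted_BS X R^o psi.
Proof.
have [x [x1 psix]] := flattened_point.
split; first by exists x; exact: flattened_attains.
move=> h psih; have psiNh : strong_bj_orth psi (- h).
  by move=> l l0; rewrite scalerN -scaleNr; apply: psih => /eqP; rewrite oppr_eq0 => /eqP.
have [y [y1 psiy hy]] := flattened_orth_test psih.
have [z [z1 psiz hz]] := flattened_orth_test psiNh.
have {}hz : h z <= 0 by rewrite -oppr_ge0.
have [t [t0 t1 tE]] : exists t, [/\ 0 <= t, t <= 1 & t * h y + (1 - t) * h z = 0].
  (* Equal values are both 0, because of their signs. *)
  have [hyz|hyz] := eqVneq (h y - h z) 0.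
    by exists 0; split=> //; rewrite mul0r subr0 mul1r add0r; lra.
  have hyz0 : 0 < h y - h z by rewrite lt0r hyz subr_ge0 (le_trans hz).
  exists (- h z / (h y - h z)); split.
  - by rewrite divr_ge0 ?oppr_ge0// ltW.
  - by rewrite ler_pdivrMr// mul1r lerDr.
  - by field.
exists (t *: y + (1 - t) *: z).
  apply: flattened_attains.
    rewrite (le_trans (ler_normD _ _))// !normrZ !ger0_norm ?subr_ge0//; nra.
  by rewrite linearD !linearZ/= psiy psiz -mulrDl addrC subrK mul1r.
move=> l; have -> : h (t *: y + (1 - t) *: z) = 0 by rewrite linearD !linearZ.
by rewrite scaler0 addr0.
Qed.

End flattened.
(** On the set [E] where [|g| >= N - e / 2], [g] is replaced by [M] times its sign. With
    [M = N + e / 2] this moves it by at most [e], and off [E] its modulus is below [M - e]. *)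
Lemma L1_adjusted_BS_dense : (0 < mu setT)%E -> dense (adjusted_BS X R^o).
Proof.
move=> mu0; apply/normed_denseP => phi e e0.
have [g [mg gN phiE]] := L1_representation phi.
pose N := `|phi|; pose a := N - e / 2; pose M := N + e / 2.
have e20 : 0 < e / 2 by rewrite divr_gt0.
have M0 : 0 < M by rewrite ltr_wpDl// normr_ge0.
pose E := [set x | a <= `|g x|]; pose G := [set x | 0 <= g x].
have mE : measurable E.
  by apply: (superlevel_measurable a (g := fun x => `|g x|)); exact: measurableT_comp.
have mG : measurable G by exact: superlevel_measurable.
(* The sign of [g], taken to be 1 at zeros so that [s * s = 1] everywhere. *)
pose s x : R := 2 * \1_G x - 1.
have sE x : s x = if 0 <= g x then 1 else -1.
  rewrite /s indicE; have [gx|gx] := boolP (0 <= g x).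
    by rewrite mem_set// mulr1; ring.
  by rewrite memNset ?mulr0 ?sub0r//; exact/negP.
have ms : measurable_fun setT s.
  by apply: measurable_funB => //; apply: measurable_funM => //; exact: measurable_indic.
pose g' x := \1_E x * (s x * M - g x) + g x.
have mg' : measurable_fun setT g'.
  apply: measurable_funD => //; apply: measurable_funM; first exact: measurable_indic.
  by apply: measurable_funB => //; exact: measurable_funM.
have g'E x : E x -> g' x = s x * M.
  by move=> xE; rewrite /g' indicE mem_set// mul1r subrK.
have g'nE x : ~ E x -> g' x = g x.
  by move=> xE; rewrite /g' indicE memNset// mul0r add0r.
have g'g x : `|g' x - g x| <= e.
  have [xE|xE] := pselect (E x); last by rewrite g'nE// subrr normr0 ltW.
  rewrite g'E// sE; have := gN x; move: xE; rewrite /E/= /a /M -/N.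
  by have [g0|g0] := leP 0 (g x); [rewrite (ger0_norm g0)|rewrite (ltr0_norm g0)];
    move=> h1 h2; rewrite ler_norml; apply/andP; split; lra.
have s1 x : s x * s x = 1 by rewrite sE; case: ifP => _; ring.
(* If [E] were null, [|phi|] would be at most [a], which is less than [N]; for negative [a], [E] is
   the whole space. *)
have muE : mu E != 0%E.
  apply/negP => /eqP muE0; have [a0|a0] := leP 0 a; last first.
    have ET : E = setT by apply/seteqP; split=> x // _; rewrite /E/= (le_trans (ltW a0)).
    by move: mu0; rewrite -ET muE0 ltxx.
  have : N <= a.
    apply: (L1_functional_norm_le a0 mg gN _ phiE).
    apply: (@negligibleS _ _ _ mu E); last exact/negligibleP.
    by move=> x /negP; rewrite -ltNge => /ltW.
  by rewrite /a; lra.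
have g'M x : `|g' x| <= M + `|phi| + e.
  rewrite -(subrK (g x) (g' x)) (le_trans (ler_normD _ _))//.
  by have := gN x; have := g'g x; lra.
have [psi _ psiE] := L1_density mu (le_trans (normr_ge0 _) (g'M point)) mg' g'M.
exists psi.
  apply: (@flattened_adjusted_BS g' s E M e psi) => // x xE.
  rewrite g'nE//; move: xE; rewrite /E/= => /negP; rewrite -ltNge /a /M => h; lra.
apply: (@L1_functional_norm_le _ (fun x => g' x - g x) e) => //.
- exact: ltW.
- exact: measurable_funB.
- exact: nearW.
- move=> f fi; rewrite -[LHS]/(psi (L1_class mu f) - phi (L1_class mu f)).
  rewrite psiE// phiE// -RintegralB//; last 2 first.
    exact: (integrable_bounded_mul mg' g'M).
    exact: (integrable_bounded_mul mg gN).
  by apply: eq_Rintegral => x _; rewrite mulrBl.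
Qed.

End L1_functionals.

(** * The case of Lebesgue measure on [0, 1] *)

Lemma lebesgue01T (R : realType) : lebesgue01 R setT = 1%E.
Proof.
rewrite /lebesgue01/= /mrestr setTI lebesgue_measure_itv/= lte_fin ltr01.
by rewrite oppr0 adde0.
Qed.

Lemma lebesgue01_finite (R : realType) : fin_num_fun (lebesgue01 R).
Proof.
move=> A mA; rewrite ge0_fin_numE// (@le_lt_trans _ _ (lebesgue01 R setT))//.
  by rewrite le_measure ?inE.
by rewrite lebesgue01T ltry.
Qed.

Lemma L1_01_adjusted_BS_dense (R : realType) : dense (adjusted_BS (L1_01 R) R^o).
Proof.
(* Finiteness is added to the same measure structure, so the L^1 space is unchanged. *)
pose F := Measure_isFinite.Build _ _ _ (lebesgue01 R) (@lebesgue01_finite R).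
pose mu : {finite_measure set (measurableTypeR R) -> \bar R} :=
  HB.pack (Measure.sort (lebesgue01 R)) (Measure.class (lebesgue01 R)) F.
by apply: (L1_adjusted_BS_dense (mu := mu)); rewrite /= lebesgue01T.
Qed.

Theorem corollary2p14 (R : realType) (Y : completeNormedModType R) :
  property_quasi_beta Y ->
  dense (adjusted_BS (L1_01 R) Y).
Proof.
by move=> Yqb; apply: adjusted_BS_dense => //; exact: L1_01_adjusted_BS_dense.
Qed.
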